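(* Let $t\in\mathbb{Q}$ and let $E=E(t)$ be an elliptic curve over $\mathbb{Q}$ with $j(E)=j(t)$, where $$j(t)=\frac{5^4t^3(t^2+5t+10)^3(2t^2+5t+5)^3(4t^4+30t^3+95t^2+150t+100)^3}{(t^2+5t+5)^5(t^4+5t^3+15t^2+25t+25)^5},$$ such that the image of the Galois representation $\varrho_{E,5}$ on $E[5]$ is (up to conjugation in $\mathrm{GL}_2(\mathbb{F}_5)$) the group $G=\langle a,b\rangle$ defined in the context. Then the three quadratic subfields of $\mathbb{Q}(E[5])/\mathbb{Q}$ are $$K_1=\mathbb{Q}\big(\sqrt{-(3t^2+10t+15)}\big),\qquad \mathbb{Q}(\sqrt5),\qquad K_2=\mathbb{Q}\big(\sqrt{-5(3t^2+10t+15)}\big).$$ Moreover, $\varrho_{E,5}$ is isomorphic to both $\mathrm{Ind}_{K_1}^{\mathbb{Q}}(r_1)$ and $\mathrm{Ind}_{K_2}^{\mathbb{Q}}(r_2)$, where $$r_1\colon\mathrm{Gal}(\mathbb{Q}(E[5])/K_1)\simeq\langle a\rangle\to\mathbb{F}_{25}^*,\quad r_1(a)=\eta,\ \ \eta^2=2,$$ $$r_2\colon\mathrm{Gal}(\mathbb{Q}(E[5])/K_2)\simeq\langle ab\rangle\to\mathbb{F}_{25}^*,\quad r_2(ab)=\eta',\ \ \eta'^2=3=\eta^6.$$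
   Context: $\varrho_{E,5}\colon\mathrm{Gal}(\overline{\mathbb{Q}}/\mathbb{Q})\to\mathrm{GL}_2(\mathbb{F}_5)$ is the representation on the $5$-torsion $E[5]$, factoring through $\mathrm{Gal}(\mathbb{Q}(E[5])/\mathbb{Q})$, which is identified with its image. $G\subset\mathrm{GL}_2(\mathbb{F}_5)$ is the group of order $16$ (the modular maximal-cyclic group $M_4(2)=\langle a,b\mid a^8=b^2=1,\ bab=a^5\rangle$) generated by $$a=\begin{pmatrix}0&1\\2&0\end{pmatrix},\qquad b=\begin{pmatrix}4&0\\0&1\end{pmatrix};$$ up to conjugacy it is the unique subgroup of $\mathrm{GL}_2(\mathbb{F}_5)$ isomorphic to $M_4(2)$. Its index-two subgroups are $\langle a\rangle$, $\langle ab\rangle$ (both cyclic of order $8$) and $\langle b\rangle\times\langle a^2\rangle$. The isomorphisms $\mathrm{Gal}(\mathbb{Q}(E[5])/K_1)\simeq\langle a\rangle$ and $\mathrm{Gal}(\mathbb{Q}(E[5])/K_2)\simeq\langle ab\rangle$ are those coming from a suitable choice of basis of $E[5]$ identifying $\mathrm{Gal}(\mathbb{Q}(E[5])/\mathbb{Q})$ with $G$. Isomorphism of representations is over $\mathbb{F}_{25}$. The function $j(t)$ is the forgetful map $X_G(5)\to X(1)$ for the genus-zero modular curve $X_G(5)$ with Hauptmodul $t$. *)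

(* Defs.v *)
From mathcomp Require Import all_boot all_order all_algebra all_fingroup.
From mathcomp Require Import all_solvable all_field all_character.

Set Implicit Arguments.
Unset Strict Implicit.
Unset Printing Implicit Defensive.

Import GroupScope GRing.Theory.
Local Open Scope ring_scope.

(* y^2 + a1 x y + a3 y = x^3 + a2 x^2 + a4 x + a6. *)
Record weierstrass (F : Type) :=
  Weierstrass { ec_a1 : F; ec_a2 : F; ec_a3 : F; ec_a4 : F; ec_a6 : F }.

(* None is the point at infinity. *)
Definition point (F : Type) : Type := option (F * F).

Section Weierstrass.
Variables (F : fieldType) (E : weierstrass F).
Local Notation a1 := (ec_a1 E).
Local Notation a2 := (ec_a2 E).
Local Notation a3 := (ec_a3 E).
Local Notation a4 := (ec_a4 E).
Local Notation a6 := (ec_a6 E).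

Definition ec_b2 : F := a1 ^+ 2 + 4 * a2.
Definition ec_b4 : F := 2 * a4 + a1 * a3.
Definition ec_b6 : F := a3 ^+ 2 + 4 * a6.
Definition ec_b8 : F :=
  a1 ^+ 2 * a6 + 4 * a2 * a6 - a1 * a3 * a4 + a2 * a3 ^+ 2 - a4 ^+ 2.
Definition ec_c4 : F := ec_b2 ^+ 2 - 24 * ec_b4.
Definition ec_disc : F :=
  - ec_b2 ^+ 2 * ec_b8 - 8 * ec_b4 ^+ 3 - 27 * ec_b6 ^+ 2
  + 9 * ec_b2 * ec_b4 * ec_b6.
Definition ec_j : F := ec_c4 ^+ 3 / ec_disc.

Definition on_curve (P : point F) : bool :=
  if P is Some (x, y) then
    y ^+ 2 + a1 * x * y + a3 * y == x ^+ 3 + a2 * x ^+ 2 + a4 * x + a6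
  else true.

Definition ec_add (P Q : point F) : point F :=
  match P, Q with
  | None, _ => Q
  | _, None => P
  | Some (x1, y1), Some (x2, y2) =>
    if (x1 == x2) && (y2 == - y1 - a1 * x1 - a3) then None else
    let l := if x1 == x2
             then (3 * x1 ^+ 2 + 2 * a2 * x1 + a4 - a1 * y1)
                  / (2 * y1 + a1 * x1 + a3)
             else (y2 - y1) / (x2 - x1) in
    let x3 := l ^+ 2 + a1 * l - a2 - x1 - x2 in
    Some (x3, - (y1 + l * (x3 - x1)) - a1 * x3 - a3)
  end.

Definition torsion (n : nat) (P : point F) : bool :=
  on_curve P && (iter n (ec_add P) None == None).

End Weierstrass.

Definition map_curve (F F' : Type) (f : F -> F') (E : weierstrass F) :=
  Weierstrass (f (ec_a1 E)) (f (ec_a2 E)) (f (ec_a3 E)) (f (ec_a4 E))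
              (f (ec_a6 E)).

Definition map_point (F F' : Type) (f : F -> F') (P : point F) : point F' :=
  omap (fun xy => (f xy.1, f xy.2)) P.

Section Torsion.
Variable E : weierstrass rat.
Let Ebar : weierstrass algC := map_curve ratr E.

(* With algC as the algebraic closure of Q, the number field L, embedded in
   algC by iota, is Q(E[n]): it is generated over Q by finitely many elements,
   whose images under iota are exactly the coordinates of the affine n-torsion
   points over algC. *)
Definition division_field (n : nat) (L : splittingFieldType rat)
    (iota : {rmorphism L -> algC}) : Prop :=
  exists2 s : seq L,
    <<1 & s>>%VS = fullv &
    forall z : algC, z \in map iota s <->
      exists xy : algC * algC, torsion Ebar n (Some xy) /\ (z = xy.1 \/ z = xy.2).

(* A basis of E[5], given as the isomorphism F_5^2 -> E[5] that it induces. *)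
Definition torsion5_basis (e : 'rV['F_5]_2 -> point algC) : Prop :=
  [/\ forall u v, e (u + v) = ec_add Ebar (e u) (e v),
      injective e &
      forall P, torsion Ebar 5 P <-> exists v, e v = P].

End Torsion.

(* rho is the matrix representation of Gal(L/Q) on E[5] in the basis e.  Row i
   of rho sigma holds the coordinates of sigma applied to the i-th basis point;
   as the product of gal_of L is (x * y) z = y (x z), row vectors (and not
   column vectors) make sigma |-> rho sigma multiplicative. *)
Definition torsion5_repr (L : splittingFieldType rat)
    (iota : {rmorphism L -> algC}) (e : 'rV['F_5]_2 -> point algC)
    (rho : mx_representation 'F_5 'Gal({:L} / 1) 2) : Prop :=
  forall sigma, sigma \in 'Gal({:L} / 1) ->
  forall (P : point L) (v : 'rV['F_5]_2),
    map_point iota P = e v ->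
    map_point iota (map_point sigma P) = e (v *m rho sigma).

Definition mx2 (R : Type) (x y z w : R) : 'M[R]_2 :=
  \matrix_(i, j) if i == 0 then (if j == 0 then x else y)
                 else (if j == 0 then z else w).

Definition mx_a : 'M['F_5]_2 := mx2 0 1 2 0.
Definition mx_b : 'M['F_5]_2 := mx2 4 0 0 1.

Lemma mx_a_unit : mx_a \is a GRing.unit.
Proof. by apply/unitrP; exists (mx2 0 3 1 0); split;
  apply/matrixP=> i j; rewrite !mxE !big_ord_recl big_ord0 !mxE;
  case: i j => [[|[|i]] ?] [[|[|j]] ?] //; apply/val_inj. Qed.

Lemma mx_b_unit : mx_b \is a GRing.unit.
Proof. by apply/unitrP; exists (mx2 4 0 0 1); split;
  apply/matrixP=> i j; rewrite !mxE !big_ord_recl big_ord0 !mxE;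
  case: i j => [[|[|i]] ?] [[|[|j]] ?] //; apply/val_inj. Qed.

Definition gl_a : {'GL_2['F_5]} := FinRing.unit 'M['F_5]_2 mx_a_unit.
Definition gl_b : {'GL_2['F_5]} := FinRing.unit 'M['F_5]_2 mx_b_unit.
Definition G16 : {group {'GL_2['F_5]}} := <<[set gl_a; gl_b]>>%G.

Section Induced.
Variables (F : fieldType) (gT : finGroupType) (G H : {group gT}).
Hypothesis sHG : H \subset G.
Variables (n : nat) (rH : mx_representation F H n).

Definition transv (i : 'I_#|G : H|) : gT :=
  repr (enum_val (i : 'I_#|rcosets H G|)).

(* Block (i, j) of the matrix of g is rH (t_i g t_j^-1) if H t_i g = H t_j and
   0 otherwise, for t_0, t_1, ... representatives of the right cosets of H. *)
Definition induced_mx (g : gT) : 'M[F]_(\sum_(i < #|G : H|) n) :=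
  \mxblock_(i < #|G : H|, j < #|G : H|)
    (if (transv i * g * (transv j)^-1)%g \in H
     then rH (transv i * g * (transv j)^-1)%g else 0).

Lemma transv_rcoset i : H :* transv i = enum_val (i : 'I_#|rcosets H G|).
Proof.
have /rcosetsP[x Gx eqx] := enum_valP (i : 'I_#|rcosets H G|).
by rewrite /transv eqx rcoset_repr.
Qed.

Lemma transv_in i : transv i \in G.
Proof.
have /rcosetsP[x Gx eqx] := enum_valP (i : 'I_#|rcosets H G|).
have: transv i \in H :* x by rewrite -eqx -transv_rcoset rcoset_refl.
by case/rcosetP=> y Hy ->; rewrite groupM // (subsetP sHG).
Qed.

Lemma transv_inj i j : (transv i * (transv j)^-1)%g \in H -> i = j.
Proof.
rewrite -mem_rcoset => /rcoset_eqP; rewrite !transv_rcoset.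
exact: enum_val_inj.
Qed.

Lemma transv_ex x : x \in G -> exists i, (x * (transv i)^-1)%g \in H.
Proof.
move=> Gx; have Rx: H :* x \in rcosets H G by apply/rcosetsP; exists x.
exists (enum_rank_in Rx (H :* x)); rewrite -mem_rcoset transv_rcoset.
by rewrite enum_rankK_in // rcoset_refl.
Qed.

Lemma induced_mx_repr : mx_repr G induced_mx.
Proof.
split=> [|x y Gx Gy].
  rewrite -[RHS]submxblockK; apply/eq_mxblock => i j.
  apply/matrixP=> u v; rewrite mulg1 !mxE -val_eqE tagnat.eq_Rank.
  have [-> | neij] := eqVneq i j.
    by rewrite mulgV group1 repr_mx1 mxE.
  by case: ifP => [/transv_inj/eqP | _]; rewrite ?(negPf neij) ?mxE.
rewrite mul_mxblock; apply/eq_mxblock => i k.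
have [j Hj] := transv_ex (groupM (transv_in i) Gx).
rewrite (bigD1 j) //= Hj big1 => [|j' ne_j'j]; last first.
  case: ifP => Hj'; last by rewrite mul0mx.
  case/eqP: ne_j'j; apply: transv_inj.
  by rewrite -(groupMl _ Hj') mulgA mulgKV.
have def_xy: (transv i * (x * y) * (transv k)^-1
              = (transv i * x * (transv j)^-1)
                * (transv j * y * (transv k)^-1))%g.
  by rewrite !mulgA mulgKV.
rewrite addr0 def_xy groupMl //; case: ifP => Hk; last by rewrite mulmx0.
by rewrite repr_mxM.
Qed.

Definition induced_repr := MxRepresentation induced_mx_repr.

End Induced.

Definition j_map (t : rat) : rat :=
  5 ^+ 4 * t ^+ 3 * (t ^+ 2 + 5 * t + 10) ^+ 3
  * (2 * t ^+ 2 + 5 * t + 5) ^+ 3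
  * (4 * t ^+ 4 + 30 * t ^+ 3 + 95 * t ^+ 2 + 150 * t + 100) ^+ 3
  / ((t ^+ 2 + 5 * t + 5) ^+ 5
     * (t ^+ 4 + 5 * t ^+ 3 + 15 * t ^+ 2 + 25 * t + 25) ^+ 5).

(* Main.v *)
(* PGL_2(F_5) is isomorphic to S_5, and the image of G16 in it is generated by
   two commuting transpositions.  The corresponding quintic resolvent of E is
   s^3 (s^2 + 5 s + 40) = j(E); at j(E) = j(t) it has a rational root and two
   quadratic factors, with discriminants -(3t^2+10t+15) and -5(3t^2+10t+15) up
   to squares.  So it suffices to show that Q(E[5]) contains sqrt 5 and a root
   other than the rational one.  Put E in Tate normal form at a point P of order
   5, with parameter d.  The isogeny with kernel <P> maps the other 5-torsion
   points to the kernel of the dual isogeny, whose two abscissas differ by a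
   rational multiple of sqrt 5.  The icosahedral parameter rho of X(5) then
   satisfies a quadratic equation, and rho^5 is a known function of d, so that
   rho is in Q(E[5]).  As Q runs through a coset of <P> one obtains five values
   of rho and five roots of the resolvent, which are not all equal.

   Since sqrt 5 is fixed by b, its field corresponds to <b, a^2>; the two other
   quadratic fields, which are imaginary, correspond to <a> and <ab>, and the
   normaliser of G16 exchanges these two.  The representations r1 and r2 are the
   actions on eigenvectors of a and ab, and the induced representations are
   obtained by Frobenius reciprocity. *)
Require Import Defs.
From mathcomp Require Import all_boot all_order all_algebra all_fingroup.
From mathcomp Require Import all_solvable all_field all_character.
From mathcomp Require Import ring lra.

Set Implicit Arguments.
Unset Strict Implicit.
Unset Printing Implicit Defensive.

Import GroupScope Order.TTheory GRing.Theory Num.Theory.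
Local Open Scope ring_scope.

(** * The Tate normal form and the icosahedral parameter *)

Definition tate (F : fieldType) (d : F) : weierstrass F :=
  Weierstrass (1 - d) (- d) (- d) 0 0.

Section TateAlgebra.
Variable F : fieldType.
Implicit Types d x y s w r u rho : F.

(* Velu's formula: velu_num / velu_den is, up to a constant depending on d, the
   x-coordinate of the isogeny with kernel generated by (0, 0). *)
Definition velu_num d x : F :=
  x ^+ 5 - 2 * d * x ^+ 4 + (d ^+ 3 + 3 * d ^+ 2 - d) * x ^+ 3
  + (3 * d ^+ 2 - 3 * d ^+ 3) * x ^+ 2 + (d ^+ 4 - 3 * d ^+ 3) * x + d ^+ 4.
Definition velu_den d x : F := (x * (x - d)) ^+ 2.

(* The left-hand side is -4 times the 5-division polynomial; it only depends on
   the image of the point under the isogeny, through a quadratic polynomial of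
   discriminant 5 times a square. *)
Lemma tate_psi5 d x :
  let b2 := ec_b2 (tate d) in let b4 := ec_b4 (tate d) in
  let b6 := ec_b6 (tate d) in let b8 := ec_b8 (tate d) in
  let psi2 := 4 * x ^+ 3 + b2 * x ^+ 2 + 2 * b4 * x + b6 in
  let psi3 := 3 * x ^+ 4 + b2 * x ^+ 3 + 3 * b4 * x ^+ 2 + 3 * b6 * x + b8 in
  4 * (psi3 ^+ 3 - (6 * x ^+ 2 + b2 * x + b4) * psi3 * psi2 ^+ 2 + psi2 ^+ 4) =
  - x * (x - d) * (5 * (2 * velu_num d x + (1 - d + d ^+ 2) * velu_den d x) ^+ 2
         - ((d ^+ 2 - 11 * d - 1) * velu_den d x) ^+ 2).
Proof.
rewrite /ec_b2 /ec_b4 /ec_b6 /ec_b8 /velu_num /velu_den /=.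
ring.
Qed.

Lemma tate_j d : d != 0 -> d ^+ 2 - 11 * d - 1 != 0 ->
  ec_j (tate d) =
  (d ^+ 4 - 12 * d ^+ 3 + 14 * d ^+ 2 + 12 * d + 1) ^+ 3
    / (d ^+ 5 * (d ^+ 2 - 11 * d - 1)).
Proof.
move=> d0 d1; rewrite /ec_j /ec_disc /ec_c4 /ec_b2 /ec_b4 /ec_b6 /ec_b8 /=.
congr (_ / _); ring.
Qed.

Lemma tate_disc d : ec_disc (tate d) = d ^+ 5 * (d ^+ 2 - 11 * d - 1).
Proof. rewrite /ec_disc /ec_b2 /ec_b4 /ec_b6 /ec_b8 /=; ring. Qed.

(** The chord through (0, 0) and (x, y) meets the curve again at abscissa d y / x^2, so this is the
    invariance of Velu's function under translation by the kernel. *)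
Lemma velu_translate d x y : x != 0 ->
  y ^+ 2 + (1 - d) * x * y - d * y = x ^+ 3 - d * x ^+ 2 ->
  velu_num d (d * y / x ^+ 2) * velu_den d x =
  velu_num d x * velu_den d (d * y / x ^+ 2).
Proof.
move=> x0 e.
suff: x ^+ 10 * (velu_num d (d * y / x ^+ 2) * velu_den d x -
  velu_num d x * velu_den d (d * y / x ^+ 2)) = 0.
  by move/eqP; rewrite mulf_eq0 expf_eq0 (negPf x0) /= subr_eq0 => /eqP.
have e2 : y ^+ 2 = x ^+ 3 - d * x ^+ 2 + d * y - (1 - d) * x * y by rewrite -e; ring.
have e3 : y ^+ 3 = (x ^+ 3 - d * x ^+ 2 + d * y - (1 - d) * x * y) * y by rewrite -e2; ring.
have e4 : y ^+ 4 = (x ^+ 3 - d * x ^+ 2 + d * y - (1 - d) * x * y) ^+ 2 by rewrite -e2; ring.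
have e5 : y ^+ 5 = (x ^+ 3 - d * x ^+ 2 + d * y - (1 - d) * x * y) ^+ 2 * y by rewrite -e2; ring.
rewrite /velu_num /velu_den.
(* The factor x^10 clears the denominators; what remains vanishes modulo the curve equation, solved
   for y^2 in [e2]. *)
transitivity (
  (d ^+ 5 * y ^+ 5 - 2 * d * (d ^+ 4 * y ^+ 4) * x ^+ 2 +
   (d ^+ 3 + 3 * d ^+ 2 - d) * (d ^+ 3 * y ^+ 3) * x ^+ 4
  + (3 * d ^+ 2 - 3 * d ^+ 3) * (d ^+ 2 * y ^+ 2) * x ^+ 6
   + (d ^+ 4 - 3 * d ^+ 3) * (d * y) * x ^+ 8 + d ^+ 4 * x ^+ 10) *
   (x * (x - d)) ^+ 2 -
   (x ^+ 5 - 2 * d * x ^+ 4 + (d ^+ 3 + 3 * d ^+ 2 - d) * x ^+ 3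
  + (3 * d ^+ 2 - 3 * d ^+ 3) * x ^+ 2 + (d ^+ 4 - 3 * d ^+ 3) * x + d ^+ 4) *
  (d ^+ 2 * y ^+ 2 * d ^+ 2 * x ^+ 2 * (y ^+ 2 - 2 * x ^+ 2 * y + x ^+ 4))).
  by field.
ring: e2.
Qed.

Lemma velu_den_neq0 d x : x != 0 -> x != d -> velu_den d x != 0.
Proof. by move=> x0 xd; rewrite expf_neq0 // mulf_neq0 // subr_eq0. Qed.

(** Here phi is the golden ratio, psi its inverse and c = phi^5. With w = W / V and u = (1 + c d) /
    (d - c), the left-hand side is, up to a factor, w^5 + (5 w^2 + 5 w + 1) u - u^2; the right-hand
    side vanishes when [velu_sqrt5] takes the value s. *)
Lemma golden_quintic d x s : s ^+ 2 = 5 -> (2 : F) != 0 ->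
  let phi := (1 + s) / 2 in let psi := (s - 1) / 2 in
  let W := x - phi * d in let V := x + psi * d in
  let c := (11 + 5 * s) / 2 in
  4 * (W ^+ 5 * (d - c) ^+ 2 + (5 * W ^+ 2 + 5 * W * V + V ^+ 2) * V ^+ 3
    * ((1 + c * d) * (d - c)) - (1 + c * d) ^+ 2 * V ^+ 5) =
  - d * (275 + 125 * s) * (5 * (2 * velu_num d x + (1 - d + d ^+ 2) * velu_den d x)
    - s * (d ^+ 2 - 11 * d - 1) * velu_den d x).
Proof.
move=> s2 h2 phi psi W V c; rewrite /W /V /phi /psi /c /velu_num /velu_den.
by field: s2.
Qed.

(** If rho^2 = rho + w then rho^5 = (w^2 + 3 w + 1) rho + w + 2 w^2, of trace 5 w^2 + 5 w + 1 and
    norm - w^5. The hypothesis is thus the characteristic equation of rho^5 at u, and rho is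
    recovered from u by solving a linear equation. *)
Lemma fifth_root_of_quintic w u :
  w ^+ 2 + 3 * w + 1 != 0 -> w ^+ 5 + (5 * w ^+ 2 + 5 * w + 1) * u - u ^+ 2 = 0 ->
  let rho := (u - w - 2 * w ^+ 2) / (w ^+ 2 + 3 * w + 1) in
  rho ^+ 2 - rho = w /\ rho ^+ 5 = u.
Proof.
move=> b0 e rho.
have e1 : rho ^+ 2 = rho + w.
  have e' : w ^+ 5 = u ^+ 2 - (5 * w ^+ 2 + 5 * w + 1) * u by apply/eqP; rewrite -subr_eq0 -e; apply/eqP; ring.
  by rewrite /rho; field: e'.
split; first by rewrite e1; ring.
have -> : rho ^+ 5 = (w ^+ 2 + 3 * w + 1) * rho + w + 2 * w ^+ 2.
  have -> : rho ^+ 5 = (rho ^+ 2) ^+ 2 * rho by ring.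
  by rewrite e1; ring: e1.
by rewrite /rho; field.
Qed.

(** [icosa_Y] is the Hauptmodul of X_0(5), and [icosa_y] that of the split Cartan curve, a covering
    of degree 5 of X_0(5). *)
Definition icosa_y rho := rho - 1 - rho ^-1.
Definition icosa_Y rho := rho ^+ 5 - 11 - rho ^- 5.
(* quintic s is the j-invariant as a function on X_S4(5), the quotient of X(5)
   by the octahedral subgroup of PGL_2(F_5) = S_5; theta is the covering map
   X(5) -> X_S4(5) in terms of the icosahedral parameter rho. *)
Definition quintic s := s ^+ 3 * (s ^+ 2 + 5 * s + 40).
Definition theta rho := let y := icosa_y rho in
  (y ^+ 6 + 5 * y ^+ 5 + 10 * y ^+ 4 + 25 * y ^+ 3 + 50 * y ^+ 2 + 125 * y + 125)
  / icosa_Y rho.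

Lemma icosa_YE rho : rho != 0 -> let y := icosa_y rho in
  icosa_Y rho = y ^+ 5 + 5 * y ^+ 4 + 15 * y ^+ 3 + 25 * y ^+ 2 + 25 * y.
Proof. by move=> r0 y; rewrite /y /icosa_Y /icosa_y; field. Qed.

(** The right-hand side is j in terms of the Hauptmodul of X_0(5): the two routes from X(5) to the
    j-line agree. *)
Lemma quintic_theta rho : rho != 0 -> icosa_Y rho != 0 ->
  quintic (theta rho) =
  (icosa_Y rho ^+ 2 + 250 * icosa_Y rho + 3125) ^+ 3 / icosa_Y rho ^+ 5.
Proof.
move=> r0; rewrite /quintic /theta (icosa_YE r0); move: (icosa_y rho) => y Y0.
by field.
Qed.

Lemma theta_not_constant r u (R : seq F) : (5 : F) != 0 ->
  u != 0 -> u - 11 - u^-1 != 0 ->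
  uniq R -> size R = 5 -> (forall rho, rho \in R -> rho ^+ 5 = u) ->
  exists2 rho, rho \in R & theta rho != r.
Proof.
move=> h5 u0; set Y := u - 11 - u^-1 => Y0 uR sR Ru.
(* In terms of rho, the equation theta rho = r is a polynomial equation of degree
   at most 4 with coefficients in terms of u = rho^5; those of rho^2 and rho^3
   cannot both vanish. *)
have [/hasP[rho]|] := boolP (has (fun rho => theta rho != r) R); first by exists rho.
rewrite -all_predC => /allP all_r; exfalso.
(* The value at rho is u times the equation cleared of its denominator Y, with exponents reduced
   modulo 5 by rho^5 = u. *)
pose p : {poly F} := \poly_(i < 5)
  [:: - (1 + r) * Y * u; (35 + Y) * u - 5; 15 * u - 20; 20 * u + 15;
      - 5 * u - 35 - Y]`_i.
have rp rho : rho \in R -> root p rho.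
  move=> Rr; rewrite /root /p horner_poly !big_ord_recr big_ord0 /=.
  have rho0 : rho != 0.
    by apply: contraNneq u0 => r0; rewrite -(Ru _ Rr) r0 expr0n.
  have YE : icosa_Y rho = Y by rewrite /icosa_Y Ru.
  have := all_r _ Rr; rewrite /= negbK /theta YE => /eqP thr.
  have {}thr : icosa_y rho ^+ 6 + 5 * icosa_y rho ^+ 5 + 10 * icosa_y rho ^+ 4
     + 25 * icosa_y rho ^+ 3 + 50 * icosa_y rho ^+ 2 + 125 * icosa_y rho + 125
     - r * Y = 0 by rewrite -thr divfK // subrr.
  apply/eqP; rewrite add0r -[RHS](mulr0 u) -thr.
  by rewrite /Y -(Ru _ Rr) /icosa_y; field.
have p0 : p = 0.
  apply: (roots_geq_poly_eq0 (rs := R)) => //; first exact/allP.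
  by rewrite sR; apply: size_poly.
have p2 : 15 * u = 20.
  by apply/eqP; rewrite -subr_eq0; have := coef0 F 2; rewrite -p0 coef_poly /= => ->.
have p3 : 20 * u = - 15.
  by apply/eqP; rewrite -addr_eq0; have := coef0 F 3; rewrite -p0 coef_poly /= => ->.
(* Eliminating u from 15 u = 20 and 20 u = -15 leaves 20^2 + 15^2 = 5^4. *)
have : (5 : F) ^+ 4 = 0.
  have -> : (5 : F) ^+ 4 = 20 * 20 - 15 * (- 15) by ring.
  by rewrite -p3 -p2; ring.
by apply/eqP; rewrite expf_neq0.
Qed.

(* For a point of abscissa x of order 5 on tate d, the parameter rho of X(5) is
   determined by rho^2 - rho = golden_w d s x and rho^5 = golden_u d s, where
   s is the square root of 5 given by velu_sqrt5. *)
Definition golden_w d s x : F :=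
  (x - (1 + s) / 2 * d) / (x + (s - 1) / 2 * d).
Definition golden_u d s : F :=
  (1 + (11 + 5 * s) / 2 * d) / (d - (11 + 5 * s) / 2).
Definition velu_sqrt5 d x : F :=
  5 * (2 * velu_num d x + (1 - d + d ^+ 2) * velu_den d x)
    / ((d ^+ 2 - 11 * d - 1) * velu_den d x).

(** * From abscissae of order 5 to roots of the quintic *)

Section Golden.
Variables d s : F.
Hypotheses (two0 : (2 : F) != 0) (five0 : (5 : F) != 0).
Hypotheses (d0 : d != 0) (delta0 : d ^+ 2 - 11 * d - 1 != 0) (s2 : s ^+ 2 = 5).

Let c := (11 + 5 * s) / 2.

Lemma sqrt5_neq0 : s != 0.
Proof. by apply: contraNneq five0 => s0; rewrite -s2 s0 expr0n. Qed.

(** As c = phi^5, the roots of d^2 - 11 d - 1 are c and -1/c. *)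
Lemma golden_delta : (d - c) * (1 + c * d) = c * (d ^+ 2 - 11 * d - 1).
Proof. by rewrite /c; field: s2. Qed.

Lemma golden_c_neq0 : c != 0.
Proof.
have e : c * ((5 * s - 11) / 2) = 1 by rewrite /c; field: s2.
by apply: contraTneq isT => c0; move: e; rewrite c0 mul0r => /eqP; rewrite eq_sym oner_eq0.
Qed.

Lemma golden_factors : (d - c != 0) /\ (1 + c * d != 0).
Proof.
by apply/andP; rewrite -negb_or -mulf_eq0 golden_delta mulf_neq0 ?golden_c_neq0.
Qed.

Lemma golden_u_neq0 : golden_u d s != 0.
Proof. by have [? ?] := golden_factors; rewrite mulf_neq0 ?invr_eq0. Qed.

(** The involution d -> (1 + c d) / (d - c) lifts the Fricke involution T -> 125 / T of X_0(5),
    where T = (d^2 - 11 d - 1) / d. *)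
Lemma golden_YE : golden_u d s - 11 - (golden_u d s)^-1
  = 125 * d / (d ^+ 2 - 11 * d - 1).
Proof.
have [e1 e2] := golden_factors; rewrite /golden_u -/c.
have -> : 125 * d / (d ^+ 2 - 11 * d - 1) = 125 * d * c / ((d - c) * (1 + c * d)).
  by rewrite golden_delta; field; rewrite golden_c_neq0 delta0.
have c2 : c ^+ 2 = 11 * c + 1 by rewrite /c; field: s2.
by field: c2; rewrite e1 e2.
Qed.

Lemma tate_jE : let Y := golden_u d s - 11 - (golden_u d s)^-1 in
  ec_j (tate d) = (Y ^+ 2 + 250 * Y + 3125) ^+ 3 / Y ^+ 5.
Proof.
have h125 : (125 : F) != 0.
  have -> : (125 : F) = 5 ^+ 3 by ring.
  by rewrite expf_neq0.
by move=> Y; rewrite /Y golden_YE tate_j //; field; rewrite d0 h125 delta0.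
Qed.

Section Point.
Variable x : F.
Hypotheses (x0 : x != 0) (xd : x != d) (xs : velu_sqrt5 d x = s).

Let V := x + (s - 1) / 2 * d.
Let W := x - (1 + s) / 2 * d.

Lemma golden_relation : W ^+ 5 * (d - c) ^+ 2
  + (5 * W ^+ 2 + 5 * W * V + V ^+ 2) * V ^+ 3 * ((1 + c * d) * (d - c))
  - (1 + c * d) ^+ 2 * V ^+ 5 = 0.
Proof.
have h4 : (4 : F) != 0.
  have -> : (4 : F) = 2 * 2 by ring.
  by rewrite mulf_neq0.
apply: (mulfI h4); rewrite golden_quintic // mulr0.
move/eqP: xs; rewrite /velu_sqrt5 -[_ == s]subr_eq0 => /eqP e.
set k := - d * _; rewrite -(mulr0 (k * ((d ^+ 2 - 11 * d - 1) * velu_den d x))) -e.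
by field; rewrite velu_den_neq0.
Qed.

Lemma golden_W_sub_V : W - V = - s * d.
Proof. by rewrite /W /V; field. Qed.

(** If V vanished, [golden_relation] would force W = 0, against W - V = - s d. *)
Lemma golden_V_neq0 : V != 0.
Proof.
have [dc0 _] := golden_factors.
apply/negP => /eqP V0; have := golden_relation; rewrite V0 !expr0n /= !mulr0 mul0r.
rewrite addr0 subr0 => /eqP; rewrite mulf_eq0 !expf_eq0 /= (negPf dc0) orbF => /eqP W0.
have /eqP := golden_W_sub_V; rewrite W0 V0 subrr eq_sym mulf_eq0 oppr_eq0.
by rewrite (negPf sqrt5_neq0) (negPf d0).
Qed.

Lemma golden_w_denom : golden_w d s x ^+ 2 + 3 * golden_w d s x + 1 != 0.
Proof.
have V0 := golden_V_neq0.
have -> : golden_w d s x ^+ 2 + 3 * golden_w d s x + 1 = 5 * x * (x - d) / V ^+ 2.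
  rewrite /golden_w -/V -/W.
  have -> : 5 * x * (x - d) = W ^+ 2 + 3 * W * V + V ^+ 2.
    by rewrite /W /V; field: s2.
  by field.
by rewrite mulf_neq0 ?invr_eq0 ?expf_neq0 // !mulf_neq0 // subr_eq0.
Qed.

Lemma golden_rhoP : exists2 rho,
  rho ^+ 2 - rho = golden_w d s x & rho ^+ 5 = golden_u d s.
Proof.
have [dc0 _] := golden_factors; have V0 := golden_V_neq0.
have [] := @fifth_root_of_quintic (golden_w d s x) (golden_u d s) golden_w_denom.
  rewrite /golden_w /golden_u -/V -/W -/c.
  rewrite -[RHS](mul0r (V ^+ 5 * (d - c) ^+ 2)^-1) -golden_relation; field.
  by rewrite dc0.
by move=> e1 e2; eexists; [exact: e1 | exact: e2].
Qed.
End Point.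

(** In x, [golden_w] is a Moebius function of determinant s d. *)
Lemma golden_w_inj x x' : x != 0 -> x != d -> velu_sqrt5 d x = s ->
  x' != 0 -> x' != d -> velu_sqrt5 d x' = s ->
  golden_w d s x = golden_w d s x' -> x = x'.
Proof.
move=> x0 xd xs x0' xd' xs' /eqP.
have V0 := golden_V_neq0 x0 xd xs; have V0' := golden_V_neq0 x0' xd' xs'.
rewrite /golden_w eqr_div // => /eqP e; apply/eqP; rewrite -subr_eq0.
have /eqP : s * d * (x - x') = 0 by move/eqP: e; rewrite -subr_eq0 => /eqP <-; field.
by rewrite !mulf_eq0 (negPf sqrt5_neq0) (negPf d0).
Qed.

(** Distinct abscissae give distinct values of w = rho^2 - rho, hence five distinct fifth roots of
    the same u, on which [theta] is not constant. *)
Lemma tate_quintic_root r (X : seq F) : uniq X -> size X = 5 ->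
  (forall x, x \in X -> [/\ x != 0, x != d & velu_sqrt5 d x = s]) ->
  exists2 z, quintic z = ec_j (tate d) & z != r.
Proof.
move=> uX sX Xs.
pose P x rho := rho ^+ 2 - rho = golden_w d s x /\ rho ^+ 5 = golden_u d s.
have [R sR RP] : exists2 R : seq F, size R = size X &
    forall i, (i < size X)%N -> P X`_i R`_i.
  elim: X {uX sX} Xs => [|x X IH] Xs; first by exists [::].
  have [|R sR RP] := IH; first by move=> y Xy; apply: Xs; rewrite inE Xy orbT.
  have [x0 xd xs] := Xs x (mem_head _ _).
  have [rho e1 e2] := golden_rhoP x0 xd xs.
  by exists (rho :: R) => [|[|i]] //=; [rewrite sR | move=> /RP].
have u0 := golden_u_neq0.
have Y0 : golden_u d s - 11 - (golden_u d s)^-1 != 0.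
  rewrite golden_YE; have -> : (125 : F) = 5 ^+ 3 by ring.
  by rewrite !mulf_neq0 ?invr_eq0 ?expf_neq0.
have R5 rho : rho \in R -> rho ^+ 5 = golden_u d s.
  by case/(nthP 0) => i; rewrite sR => /RP[_ e] <-.
have uR : uniq R.
  apply/(uniqP 0) => i j; rewrite !inE sR => iX jX eij.
  apply/eqP; rewrite -(nth_uniq 0 iX jX uX); apply/eqP.
  have [? ? ?] := Xs _ (mem_nth 0 iX); have [? ? ?] := Xs _ (mem_nth 0 jX).
  by apply: golden_w_inj => //; have [<- _] := RP _ iX; have [<- _] := RP _ jX; rewrite eij.
have [|rho Rrho thr] := theta_not_constant r five0 u0 Y0 uR _ R5; first by rewrite sR.
exists (theta rho) => //.
have rho0 : rho != 0 by apply: contraNneq u0 => r0; rewrite -(R5 _ Rrho) r0 expr0n.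
have YE : icosa_Y rho = golden_u d s - 11 - (golden_u d s)^-1 by rewrite /icosa_Y R5.
by rewrite tate_jE -YE quintic_theta // YE.
Qed.

End Golden.
End TateAlgebra.

(** * Changes of Weierstrass coordinates *)

Definition ec_neg (F : fieldType) (E : weierstrass F) (P : point F) : point F :=
  omap (fun xy => (xy.1, - xy.2 - ec_a1 E * xy.1 - ec_a3 E)) P.

Section Negation.
Variables (F : fieldType) (E : weierstrass F).

Lemma on_curve_same_x x y y' :
  on_curve E (Some (x, y)) -> on_curve E (Some (x, y')) ->
  Some (x, y') = Some (x, y) \/ Some (x, y') = ec_neg E (Some (x, y)).
Proof.
move=> /= /eqP e /eqP e'.
have /eqP : (y' - y) * (y' - (- y - ec_a1 E * x - ec_a3 E)) = 0.
  transitivity ((y' ^+ 2 + ec_a1 E * x * y' + ec_a3 E * y')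
    - (y ^+ 2 + ec_a1 E * x * y + ec_a3 E * y)); first by ring.
  by rewrite e e' subrr.
by rewrite mulf_eq0 !subr_eq0 => /orP[/eqP ->|/eqP ->]; [left | right].
Qed.

Lemma ec_add_eq_None P Q : ec_add E P Q = None -> Q = ec_neg E P.
Proof.
case: P Q => [[x y]|] [[x' y']|] //=.
by case: ifP => // /andP[/eqP -> /eqP ->].
Qed.

(** If doubling fixed the abscissa, it would give the ordinate of the negative, a case in which the
    sum is infinite. This yields [f 0 = None] below from additivity alone, without associativity of
    [ec_add]. *)
Lemma ec_double_neq_self x y : ec_add E (Some (x, y)) (Some (x, y)) <> Some (x, y).
Proof.
move=> /=; case: ifP => // /negbT; rewrite eqxx /= => ne [e1 e2].
by move: e2 ne; rewrite e1 subrr mulr0 addr0 => e2; rewrite {1}e2 eqxx.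
Qed.

End Negation.

Section ChangeOfVariables.
Variables (F : fieldType) (E E' : weierstrass F) (u r s t : F).
Hypothesis u0 : u != 0.
(** These are the usual formulas for x = u^2 x' + r, y = u^3 y' + s u^2 x' + t, solved for E so that
    rewriting by [h6], [h4], [h3], [h2], [h1] in this order eliminates its coefficients. *)
Hypothesis h1 : ec_a1 E = u * ec_a1 E' - 2 * s.
Hypothesis h2 : ec_a2 E = u ^+ 2 * ec_a2 E' + s * ec_a1 E - 3 * r + s ^+ 2.
Hypothesis h3 : ec_a3 E = u ^+ 3 * ec_a3 E' - r * ec_a1 E - 2 * t.
Hypothesis h4 : ec_a4 E = u ^+ 4 * ec_a4 E' + s * ec_a3 E - 2 * r * ec_a2 E
  + (t + r * s) * ec_a1 E - 3 * r ^+ 2 + 2 * s * t.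
Hypothesis h6 : ec_a6 E = u ^+ 6 * ec_a6 E' - r * ec_a4 E - r ^+ 2 * ec_a2 E - r ^+ 3
  + t * ec_a3 E + t ^+ 2 + r * t * ec_a1 E.

Definition change_point (P : point F) : point F :=
  omap (fun xy => ((xy.1 - r) / u ^+ 2,
                   (xy.2 - s * (xy.1 - r) - t) / u ^+ 3)) P.

Lemma change_on_curve P : on_curve E P -> on_curve E' (change_point P).
Proof.
case: P => [[x y]|] //= /eqP e; apply/eqP/(mulfI (expf_neq0 6 u0)).
apply/eqP; rewrite -subr_eq0; apply/eqP.
transitivity ((y ^+ 2 + ec_a1 E * x * y + ec_a3 E * y)
   - (x ^+ 3 + ec_a2 E * x ^+ 2 + ec_a4 E * x + ec_a6 E)); last by rewrite e subrr.
by rewrite h6 h4 h3 h2 h1; field.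
Qed.

Lemma change_disc : ec_disc E = u ^+ 12 * ec_disc E'.
Proof.
rewrite /ec_disc /ec_b2 /ec_b4 /ec_b6 /ec_b8 h6 h4 h3 h2 h1.
ring.
Qed.

Lemma change_c4 : ec_c4 E = u ^+ 4 * ec_c4 E'.
Proof. by rewrite /ec_c4 /ec_b2 /ec_b4 h4 h3 h2 h1; ring. Qed.

Lemma change_j : ec_j E = ec_j E'.
Proof.
rewrite /ec_j change_c4 change_disc exprMn -exprM -mulf_div divff ?mul1r //.
by rewrite expf_neq0.
Qed.

Lemma change_point_inj : injective change_point.
Proof.
case=> [[x y]|] [[x' y']|] //= [].
move=> /(mulIf (invr_neq0 (expf_neq0 2 u0))) /addIr ->.
by move=> /(mulIf (invr_neq0 (expf_neq0 3 u0))) /addIr /addIr ->.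
Qed.

(** A line of slope l is carried to one of slope (l - s) / u. *)
Lemma change_line l x y x' :
  let x3 := l ^+ 2 + ec_a1 E * l - ec_a2 E - x - x' in
  let X := (x - r) / u ^+ 2 in let Y := (y - s * (x - r) - t) / u ^+ 3 in
  let L := (l - s) / u in
  let X3 := L ^+ 2 + ec_a1 E' * L - ec_a2 E' - X - (x' - r) / u ^+ 2 in
  change_point (Some (x3, - (y + l * (x3 - x)) - ec_a1 E * x3 - ec_a3 E))
  = Some (X3, - (Y + L * (X3 - X)) - ec_a1 E' * X3 - ec_a3 E').
Proof.
move=> x3 X Y L X3; have e : (x3 - r) / u ^+ 2 = X3.
  by rewrite /x3 /X3 /L /X h2 h1; field.
congr (Some (_, _)) => //=; rewrite -e /L /X /Y h3 h1; field.
exact: u0.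
Qed.

Local Arguments change_point : simpl never.

(** Membership in the curve matters when the abscissae agree: two such points that are not opposite
    are equal, so that the tangent slope is the right one. *)
Lemma change_add P Q : on_curve E P -> on_curve E Q ->
  change_point (ec_add E P Q) = ec_add E' (change_point P) (change_point Q).
Proof.
case: P Q => [[x y]|] [[x' y']|] // Pc Qc.
have ex : ((x - r) / u ^+ 2 == (x' - r) / u ^+ 2) = (x == x').
  by rewrite (inj_eq (mulIf (invr_neq0 (expf_neq0 2 u0)))) (inj_eq (addIr _)).
have ey : ((y' - s * (x' - r) - t) / u ^+ 3 == - ((y - s * (x - r) - t) / u ^+ 3)
     - ec_a1 E' * ((x - r) / u ^+ 2) - ec_a3 E') =
  (y' - s * (x' - x) == - y - ec_a1 E * x - ec_a3 E).
  rewrite -[LHS](inj_eq (mulfI (expf_neq0 3 u0))) -[LHS]subr_eq0 -[RHS]subr_eq0.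
  by congr (_ == 0); rewrite h3 h1; field.
rewrite [in RHS]/change_point [RHS]/= ex ey [in LHS]/ec_add; have [exx|nx] := eqVneq x x'; last first.
  rewrite /= change_line; do !congr (Some _).
  suff -> : ((y' - s * (x' - r) - t) / u ^+ 3 - (y - s * (x - r) - t) / u ^+ 3)
    / ((x' - r) / u ^+ 2 - (x - r) / u ^+ 2) = ((y' - y) / (x' - x) - s) / u by [].
  by field; rewrite u0 subr_eq0 eq_sym nx.
subst x'; rewrite subrr mulr0 subr0 /=.
have [//|ny] := eqVneq y' (- y - ec_a1 E * x - ec_a3 E).
have [[eyy]|[eyy]] := on_curve_same_x Pc Qc; last by case/eqP: ny.
subst y'; have D0 : 2 * y + ec_a1 E * x + ec_a3 E != 0.
  by apply: contraNneq ny => D0; rewrite -subr_eq0 -D0; apply/eqP; ring.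
rewrite change_line.
suff -> : (3 * ((x - r) / u ^+ 2) ^+ 2 + 2 * ec_a2 E' * ((x - r) / u ^+ 2)
    + ec_a4 E' - ec_a1 E' * ((y - s * (x - r) - t) / u ^+ 3))
  / (2 * ((y - s * (x - r) - t) / u ^+ 3) + ec_a1 E' * ((x - r) / u ^+ 2) + ec_a3 E')
  = ((3 * x ^+ 2 + 2 * ec_a2 E * x + ec_a4 E - ec_a1 E * y)
     / (2 * y + ec_a1 E * x + ec_a3 E) - s) / u by [].
have D'E : 2 * ((y - s * (x - r) - t) / u ^+ 3) + ec_a1 E' * ((x - r) / u ^+ 2) + ec_a3 E'
     = (2 * y + ec_a1 E * x + ec_a3 E) / u ^+ 3.
  by rewrite h3 h1; field.
rewrite D'E; apply: (mulIf u0); apply: (mulIf D0).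
transitivity (3 * (x - r) ^+ 2 + u ^+ 2 * (2 * ec_a2 E' * (x - r)) +
   u ^+ 4 * ec_a4 E' - u * ec_a1 E' * (y - s * (x - r) - t)).
  by field; rewrite u0 D0.
transitivity (3 * x ^+ 2 + 2 * ec_a2 E * x + ec_a4 E - ec_a1 E * y
   - s * (2 * y + ec_a1 E * x + ec_a3 E)); last by field; rewrite u0 D0.
by rewrite h4 h3 h2 h1; ring.
Qed.
End ChangeOfVariables.

(** * Five-torsion points *)

Lemma mulrn5_F5 (v : 'rV['F_5]_2) : v *+ 5 = 0.
Proof.
have e : (5%:R : 'F_5) = 0 by apply: val_inj.
by rewrite -scaler_nat e scale0r.
Qed.

Lemma mulrn_F5_eq0 (k : nat) (v : 'rV['F_5]_2) : (0 < k < 5)%N -> v *+ k = 0 -> v = 0.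
Proof.
move=> /andP[k0 k5]; rewrite -scaler_nat => /eqP; rewrite scaler_eq0.
case/orP=> /eqP // /(congr1 val) /=; rewrite val_Fp_nat // modn_small // => e.
by rewrite e in k0.
Qed.

Lemma F5_neq_opp (v : 'rV['F_5]_2) : v != 0 -> v != - v.
Proof.
apply: contraNneq => e; apply/eqP/(@mulrn_F5_eq0 2) => //.
by rewrite mulr2n {2}e subrr.
Qed.

Section TorsionMap.
Variables (F : fieldType) (E : weierstrass F) (f : 'rV['F_5]_2 -> point F).
Hypothesis fD : forall u v, f (u + v) = ec_add E (f u) (f v).
Hypothesis f_inj : injective f.
Hypothesis fC : forall v, on_curve E (f v).

(** By [torsion_mapE] the default (0, 0) is reached at v = 0 only. *)
Definition xcoord v := (odflt (0, 0) (f v)).1.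
Definition ycoord v := (odflt (0, 0) (f v)).2.

Lemma torsion_map0 : f 0 = None.
Proof.
case e : (f 0) => [[x y]|] //.
have := fD 0 0; rewrite addr0 e => h.
by case: (@ec_double_neq_self F E x y).
Qed.

Lemma torsion_mapE v : v != 0 -> f v = Some (xcoord v, ycoord v).
Proof.
rewrite /xcoord /ycoord; case e : (f v) => [[x y]|] //.
by rewrite -torsion_map0 in e; rewrite (f_inj e) eqxx.
Qed.

Lemma torsion_mapN v : f (- v) = ec_neg E (f v).
Proof. by apply: ec_add_eq_None; rewrite -fD subrr torsion_map0. Qed.

Lemma xcoordN v : xcoord (- v) = xcoord v.
Proof.
have [->|v0] := eqVneq v 0; first by rewrite oppr0.
by rewrite /xcoord torsion_mapN torsion_mapE.
Qed.

Lemma xcoord_inj v w : v != 0 -> w != 0 -> xcoord v = xcoord w -> v = w \/ v = - w.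
Proof.
move=> v0 w0 e.
have := fC v; have := fC w; rewrite !torsion_mapE // e => cw cv.
have [h|h] := on_curve_same_x cw cv; [left | right]; apply: f_inj.
  by rewrite !torsion_mapE // -h e.
by rewrite torsion_mapN !torsion_mapE // -h e.
Qed.

Lemma torsion_map_tangent_neq0 v : v != 0 ->
  2 * ycoord v + ec_a1 E * xcoord v + ec_a3 E != 0.
Proof.
move=> v0; apply: contraNneq (F5_neq_opp v0) => h; apply/eqP/f_inj.
rewrite torsion_mapN torsion_mapE //=; congr (Some (_, _)).
by apply/eqP; rewrite -subr_eq0 -h; apply/eqP; ring.
Qed.

Lemma torsion_map_double v : v != 0 ->
  let x := xcoord v in let y := ycoord v in
  let l := (3 * x ^+ 2 + 2 * ec_a2 E * x + ec_a4 E - ec_a1 E * y)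
           / (2 * y + ec_a1 E * x + ec_a3 E) in
  xcoord (v + v) = l ^+ 2 + ec_a1 E * l - ec_a2 E - x - x /\
  ycoord (v + v) = - (y + l * (xcoord (v + v) - x)) - ec_a1 E * xcoord (v + v) - ec_a3 E.
Proof.
move=> v0 x y l.
suff : f (v + v) = Some (l ^+ 2 + ec_a1 E * l - ec_a2 E - x - x,
   - (y + l * (l ^+ 2 + ec_a1 E * l - ec_a2 E - x - x - x)) -
     ec_a1 E * (l ^+ 2 + ec_a1 E * l - ec_a2 E - x - x) - ec_a3 E).
  by rewrite /xcoord /ycoord => ->.
rewrite fD torsion_mapE // /ec_add eqxx -/x -/y.
case: ifP => //= /eqP e; have := torsion_map_tangent_neq0 v0; rewrite -/x -/y.
suff -> : 2 * y + ec_a1 E * x + ec_a3 E = 0 by rewrite eqxx.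
by rewrite mulr_natl mulr2n {1}e; ring.
Qed.

Lemma torsion_map_chord v w : v != 0 -> w != 0 -> v != w -> v != - w ->
  let l := (ycoord w - ycoord v) / (xcoord w - xcoord v) in
  xcoord (v + w) = l ^+ 2 + ec_a1 E * l - ec_a2 E - xcoord v - xcoord w.
Proof.
move=> v0 w0 vw vNw l.
have nx : xcoord v != xcoord w.
  by apply/negP => /eqP/(xcoord_inj v0 w0)[/eqP|/eqP]; apply/negP.
by rewrite {1}/xcoord fD !torsion_mapE //= (negPf nx).
Qed.

(* Expresses x(3v) = x(-2v). *)
Lemma torsion_map_triple v : v != 0 ->
  let x := xcoord v in let y := ycoord v in
  let B := 2 * y + ec_a1 E * x + ec_a3 E in
  let l := (3 * x ^+ 2 + 2 * ec_a2 E * x + ec_a4 E - ec_a1 E * y) / B in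
  let delta := xcoord (v + v) - x in
  delta != 0 /\ delta ^+ 3 = (2 * l + ec_a1 E) * B * delta + B ^+ 2.
Proof.
move=> v0 x y B l delta.
have w0 : v + v != 0 by rewrite addr_eq0 F5_neq_opp.
have e5 : v + v + v = - (v + v).
  by apply/eqP; rewrite -addr_eq0 -(mulrn5_F5 v) !mulrSr mulr0n add0r !addrA.
have vw : v != v + v by rewrite -subr_eq0 opprD addrA subrr add0r oppr_eq0.
have vNw : v != - (v + v).
  rewrite -addr_eq0; apply: contraNneq v0 => e3.
  by apply/eqP/(@mulrn_F5_eq0 3) => //; rewrite !mulrSr mulr0n add0r -addrA.
have [] := torsion_map_double v0; rewrite -/l -/x -/y => e2 f2.
have := torsion_map_chord v0 w0 vw vNw; rewrite /= (addrC v) e5 xcoordN f2 -/x -/y.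
have B0 : B != 0 by apply: torsion_map_tangent_neq0.
have d0 : delta != 0.
  rewrite subr_eq0; apply/negP => /eqP/(xcoord_inj w0 v0)[/eqP|/eqP].
    by rewrite eq_sym; apply/negP.
  by rewrite -[v + v]opprK (inj_eq oppr_inj) eq_sym; apply/negP.
have -> : xcoord (v + v) = x + delta by rewrite /delta; ring.
rewrite (_ : x + delta - x = delta); last by ring.
move=> e3.
split=> //.
have la : l ^+ 2 + ec_a1 E * l - ec_a2 E = delta + 3 * x by rewrite /delta e2; ring.
have e4 : (- (y + l * delta) - ec_a1 E * (x + delta) - ec_a3 E - y) / delta
    = - (l + ec_a1 E + B / delta) by rewrite /B; field.
have : delta = (2 * l + ec_a1 E) * B / delta + B ^+ 2 / delta ^+ 2.
  apply: (addrI x); rewrite {1}e3 e4.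
  transitivity ((l ^+ 2 + ec_a1 E * l - ec_a2 E) + (2 * l + ec_a1 E) * B / delta
     + B ^+ 2 / delta ^+ 2 - 2 * x - delta); first by field.
  by rewrite la; ring.
move/(congr1 ( *%R^~ (delta ^+ 2))) => /= e6.
transitivity (delta * delta ^+ 2); first by ring.
by rewrite e6; field.
Qed.

(** With B the denominator of the tangent slope l and delta = x(2v) - x(v), one has psi2 = B^2 and
    psi3 = - delta B^2, and 6 x^2 + b2 x + b4 = (2 l + a1) B; the expression is then B^6 times the
    relation of [torsion_map_triple]. *)
Lemma torsion_map_psi5 v : v != 0 ->
  let x := xcoord v in
  let b2 := ec_b2 E in let b4 := ec_b4 E in
  let b6 := ec_b6 E in let b8 := ec_b8 E in
  let psi2 := 4 * x ^+ 3 + b2 * x ^+ 2 + 2 * b4 * x + b6 in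
  let psi3 := 3 * x ^+ 4 + b2 * x ^+ 3 + 3 * b4 * x ^+ 2 + 3 * b6 * x + b8 in
  psi3 ^+ 3 - (6 * x ^+ 2 + b2 * x + b4) * psi3 * psi2 ^+ 2 + psi2 ^+ 4 = 0.
Proof.
move=> v0 x b2 b4 b6 b8 psi2 psi3.
have [] := torsion_map_double v0; rewrite -/x; set y := ycoord v.
set B := 2 * y + _ + _; set M := _ - ec_a1 E * y; set l := M / B => e2 _.
have B0 : B != 0 by apply: torsion_map_tangent_neq0.
have eM : M = l * B by rewrite divfK.
have [_] := torsion_map_triple v0; rewrite -/x -/y -/B -/M -/l.
set delta := xcoord (v + v) - x => d3.
have cv : y ^+ 2 = x ^+ 3 + ec_a2 E * x ^+ 2 + ec_a4 E * x + ec_a6 E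
    - ec_a1 E * x * y - ec_a3 E * y.
  have := fC v; rewrite torsion_mapE //= -/x -/y => /eqP <-; ring.
have psi2E : psi2 = B ^+ 2.
  by rewrite /psi2 /B /b2 /b4 /b6 /ec_b2 /ec_b4 /ec_b6; ring: cv.
have psi3E : psi3 = - (delta * B ^+ 2).
  have -> : delta * B ^+ 2 = M ^+ 2 + ec_a1 E * M * B - (ec_a2 E + 3 * x) * B ^+ 2.
    by rewrite /delta e2 eM; ring.
  by rewrite /psi3 /M /B /b2 /b4 /b6 /b8 /ec_b2 /ec_b4 /ec_b6 /ec_b8; ring: cv.
have gE : 6 * x ^+ 2 + b2 * x + b4 = (2 * l + ec_a1 E) * B.
  transitivity (2 * M + ec_a1 E * B); last by rewrite eM; ring.
  by rewrite /M /B /b2 /b4 /ec_b2 /ec_b4; ring.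
rewrite gE psi3E psi2E; transitivity (B ^+ 6 * ((2 * l + ec_a1 E) * B * delta + B ^+ 2
  - delta ^+ 3)); first by ring.
by rewrite d3 subrr mulr0.
Qed.
End TorsionMap.

Definition bas1 : 'rV['F_5]_2 := delta_mx 0 0.
Definition bas2 : 'rV['F_5]_2 := delta_mx 0 1.

Lemma bas_coord1 (m n : nat) : (bas1 *+ m + bas2 *+ n) 0 0 = m%:R.
Proof. by rewrite mxE !mulmxnE !mxE /= mul0rn addr0. Qed.

Lemma bas_coord2 (m n : nat) : (bas1 *+ m + bas2 *+ n) 0 1 = n%:R.
Proof. by rewrite mxE !mulmxnE !mxE /= mul0rn add0r. Qed.

Lemma bas1_neq0 : bas1 != 0.
Proof.
by apply/negP => /eqP/rowP/(_ 0); rewrite !mxE /= => /eqP; rewrite oner_eq0.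
Qed.

(** * Torsion on the Tate normal form *)

Section TateTorsion.
Variables (F : fieldType) (d : F) (f : 'rV['F_5]_2 -> point F).
Hypothesis fD : forall u v, f (u + v) = ec_add (tate d) (f u) (f v).
Hypothesis f_inj : injective f.
Hypothesis fC : forall v, on_curve (tate d) (f v).
Hypothesis f_bas1 : f bas1 = Some (0, 0).
Hypotheses (two0 : (2 : F) != 0) (five0 : (5 : F) != 0).
Hypothesis disc0 : ec_disc (tate d) != 0.

Local Notation x := (xcoord f).

Lemma tate_d_neq0 : d != 0 /\ d ^+ 2 - 11 * d - 1 != 0.
Proof.
by move: disc0; rewrite tate_disc mulf_eq0 negb_or expf_eq0 /= => /andP.
Qed.

Lemma tate_xcoord_bas1 : x bas1 = 0. Proof. by rewrite /xcoord f_bas1. Qed.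
Lemma tate_ycoord_bas1 : ycoord f bas1 = 0. Proof. by rewrite /ycoord f_bas1. Qed.

Lemma tate_xcoord_double : x (bas1 + bas1) = d.
Proof.
have [-> _] := torsion_map_double fD f_inj bas1_neq0.
by rewrite tate_xcoord_bas1 tate_ycoord_bas1 /= !(mulr0, expr0n, addr0, mul0r, subr0, oppr0, add0r, opprK).
Qed.

Definition off_bas1 (v : 'rV['F_5]_2) := v 0 1 != 0.

Lemma off_bas1_neq0 v : off_bas1 v -> v != 0.
Proof. by apply: contraNneq => ->; rewrite mxE. Qed.

Lemma off_bas1_neq v m : off_bas1 v -> v != bas1 *+ m /\ v != - (bas1 *+ m).
Proof.
by move=> ov; split; apply: contraNneq ov => ->; rewrite ?mxE mulmxnE mxE /= mul0rn ?oppr0.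
Qed.

Lemma off_bas1D v : off_bas1 v -> off_bas1 (bas1 + v).
Proof. by rewrite /off_bas1 !mxE /= add0r. Qed.

Lemma tate_off_bas1 v : off_bas1 v -> x v != 0 /\ x v != d.
Proof.
move=> ov; have v0 := off_bas1_neq0 ov; have p0 := bas1_neq0.
have pp0 : bas1 + bas1 != 0 by rewrite addr_eq0 F5_neq_opp.
have [n1 n1'] := off_bas1_neq 1 ov; have [n2 n2'] := off_bas1_neq 2 ov.
split; apply/negP => /eqP.
  by rewrite -tate_xcoord_bas1 => /(xcoord_inj fD f_inj fC v0 p0)[/eqP|/eqP]; apply/negP.
by rewrite -tate_xcoord_double => /(xcoord_inj fD f_inj fC v0 pp0)[/eqP|/eqP]; apply/negP.
Qed.

(** Since x and x - d are nonzero, [tate_psi5] leaves its quadratic factor, which says 5 N^2 = M^2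
    for the fraction 5 N / M defining [velu_sqrt5]. *)
Lemma tate_velu_sqrt5 v : off_bas1 v -> velu_sqrt5 d (x v) ^+ 2 = 5.
Proof.
move=> ov; have [x0 xd] := tate_off_bas1 ov; have [d0 dl0] := tate_d_neq0.
have D0 := velu_den_neq0 x0 xd.
have := torsion_map_psi5 fD f_inj fC (off_bas1_neq0 ov); rewrite /=.
move/(congr1 ( *%R 4)); rewrite tate_psi5 mulr0 => /eqP.
rewrite mulf_eq0 mulf_eq0 oppr_eq0 (negPf x0) subr_eq0 (negPf xd) /= subr_eq0 => /eqP e.
apply: (mulIf (expf_neq0 2 (mulf_neq0 dl0 D0))).
rewrite /velu_sqrt5 expr_div_n divfK; last exact: (expf_neq0 2 (mulf_neq0 dl0 D0)).
by rewrite -e; ring.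
Qed.

Lemma tate_velu_translate v : off_bas1 v ->
  velu_sqrt5 d (x (bas1 + v)) = velu_sqrt5 d (x v).
Proof.
move=> ov; have [x0 xd] := tate_off_bas1 ov; have [d0 dl0] := tate_d_neq0.
have [x0' xd'] := tate_off_bas1 (off_bas1D ov).
have D0 := velu_den_neq0 x0 xd; have D0' := velu_den_neq0 x0' xd'.
have [n1 n1'] := off_bas1_neq 1 ov.
have cv := fC v; rewrite (torsion_mapE fD f_inj (off_bas1_neq0 ov)) in cv.
move: cv; rewrite /= !addr0 mul0r addr0 !mulNr => /eqP cv.
have xE : x (bas1 + v) = d * ycoord f v / x v ^+ 2.
  rewrite (torsion_map_chord fD f_inj fC bas1_neq0 (off_bas1_neq0 ov)) ?(eq_sym bas1) //; last first.
    by rewrite -[bas1]opprK (inj_eq oppr_inj).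
  rewrite tate_xcoord_bas1 tate_ycoord_bas1 /=.
  apply: (mulIf (expf_neq0 2 x0)); rewrite divfK ?expf_neq0 //.
  transitivity ((ycoord f v ^+ 2 + (1 - d) * x v * ycoord f v - d * ycoord f v)
    + d * ycoord f v + d * x v ^+ 2 - x v ^+ 3); first by field.
  by rewrite cv; ring.
have := velu_translate x0 cv; rewrite -xE => e.
rewrite /velu_sqrt5; apply/eqP; rewrite (eqr_div _ _ (mulf_neq0 dl0 D0') (mulf_neq0 dl0 D0)); apply/eqP.
transitivity (5 * (d ^+ 2 - 11 * d - 1) * (2 * (velu_num d (x (bas1 + v)) * velu_den d (x v))
  + (1 - d + d ^+ 2) * velu_den d (x (bas1 + v)) * velu_den d (x v))); first by ring.
by rewrite e; ring.
Qed.

(** On the coset of the points m bas1 + bas2, [velu_sqrt5] is constant; no two of them are opposite,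
    their second coordinates being 1, so their abscissae are distinct. *)
Lemma tate_torsion_quintic_root r : exists2 z : F, quintic z = ec_j (tate d) & z != r.
Proof.
have [d0 dl0] := tate_d_neq0.
pose pt m := bas1 *+ m + bas2 *+ 1.
have off m : off_bas1 (pt m) by rewrite /off_bas1 bas_coord2.
have vs m : velu_sqrt5 d (x (pt m)) = velu_sqrt5 d (x (pt 0)).
  by elim: m => // m <-; rewrite -(tate_velu_translate (off m)) /pt addrA -mulrS.
apply: (@tate_quintic_root F d (velu_sqrt5 d (x (pt 0))) two0 five0 d0 dl0 _ r
  [seq x (pt m) | m <- iota 0 5]).
- exact: tate_velu_sqrt5.
- rewrite map_inj_in_uniq ?iota_uniq // => m k; rewrite !mem_iota !add0n /= => m5 k5.
  move=> /(xcoord_inj fD f_inj fC (off_bas1_neq0 (off m)) (off_bas1_neq0 (off k)))[].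
    move/rowP/(_ 0); rewrite !bas_coord1 => /(congr1 val).
    by rewrite /= !val_Fp_nat // !modn_small.
  by move/rowP/(_ 1); rewrite [RHS]mxE !bas_coord2 => /(congr1 val).
- by rewrite size_map.
by move=> _ /mapP[m _ ->]; have [? ?] := tate_off_bas1 (off m).
Qed.
End TateTorsion.

(** * Reduction to the Tate normal form *)

Section NormalForm.
Variables (F : fieldType) (E : weierstrass F).
Implicit Types x y : F.

(** Moving P = (x, y) to the origin with its tangent as the axis y = 0 turns a3 into [tangent_den]
    and a2 into [double_shift], which is x(P) - x(2P). Scaling by their quotient [tate_scale] makes
    both equal to - d. *)
Definition tangent_den x y := 2 * y + ec_a1 E * x + ec_a3 E.
Definition tangent_slope x y :=
  (3 * x ^+ 2 + 2 * ec_a2 E * x + ec_a4 E - ec_a1 E * y) / tangent_den x y.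
Definition double_shift x y :=
  ec_a2 E - tangent_slope x y * ec_a1 E + 3 * x - tangent_slope x y ^+ 2.
Definition tate_param x y := - double_shift x y ^+ 3 / tangent_den x y ^+ 2.
Definition tate_scale x y := tangent_den x y / double_shift x y.
(* For a basis P = (x0, y0), Q = (x, y) of the 5-torsion; it is even in P by
   torsion_sqrt5_neg below, hence fixed by diag(-1, 1). *)
Definition torsion_sqrt5 x0 y0 x :=
  velu_sqrt5 (tate_param x0 y0) ((x - x0) / tate_scale x0 y0 ^+ 2).

(** Passing to -P changes the sign of [tangent_den] and keeps [double_shift]; both enter only
    through [tate_param] and the square of [tate_scale], which are even. *)
Lemma torsion_sqrt5_neg x0 y0 x : tangent_den x0 y0 != 0 ->
  torsion_sqrt5 x0 (- y0 - ec_a1 E * x0 - ec_a3 E) x = torsion_sqrt5 x0 y0 x.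
Proof.
move=> B0; set y1 := - y0 - _ - _.
have eB : tangent_den x0 y1 = - tangent_den x0 y0 by rewrite /tangent_den /y1; ring.
have el : tangent_slope x0 y1 = - tangent_slope x0 y0 - ec_a1 E.
  have B0' : - tangent_den x0 y0 != 0 by rewrite oppr_eq0.
  apply: (mulIf B0'); rewrite {1}/tangent_slope eB divfK //.
  transitivity (tangent_slope x0 y0 * tangent_den x0 y0 + ec_a1 E * tangent_den x0 y0).
    by rewrite divfK // /y1 /tangent_den; ring.
  by ring.
have eA : double_shift x0 y1 = double_shift x0 y0 by rewrite /double_shift el; ring.
by rewrite /torsion_sqrt5 /tate_param /tate_scale eA eB !expr_div_n sqrrN.
Qed.

Variable f : 'rV['F_5]_2 -> point F.
Hypothesis fD : forall u v, f (u + v) = ec_add E (f u) (f v).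
Hypothesis f_inj : injective f.
Hypothesis fC : forall v, on_curve E (f v).
Hypotheses (two0 : (2 : F) != 0) (five0 : (5 : F) != 0).
Hypothesis disc0 : ec_disc E != 0.

Local Notation x0 := (xcoord f bas1).
Local Notation y0 := (ycoord f bas1).

Lemma torsion_normal_form :
  torsion_sqrt5 x0 y0 (xcoord f bas2) ^+ 2 = 5 /\
  forall r, exists2 z, quintic z = ec_j E & z != r.
Proof.
have p0 := bas1_neq0.
have B0 : tangent_den x0 y0 != 0 by apply: (torsion_map_tangent_neq0 fD f_inj).
have [xx _] := torsion_map_double fD f_inj p0.
have eA : double_shift x0 y0 = x0 - xcoord f (bas1 + bas1).
  by rewrite xx /double_shift /tangent_slope /tangent_den; ring.
have [dl0] := torsion_map_triple fD f_inj fC p0.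
rewrite -/(tangent_den x0 y0) -/(tangent_slope x0 y0) => rel.
have eA' : xcoord f (bas1 + bas1) - x0 = - double_shift x0 y0 by rewrite eA opprB.
rewrite eA' in rel; rewrite eA' oppr_eq0 in dl0.
have lB : tangent_slope x0 y0 * tangent_den x0 y0 =
   3 * x0 ^+ 2 + 2 * ec_a2 E * x0 + ec_a4 E - ec_a1 E * y0 by rewrite divfK.
set B := tangent_den x0 y0 in B0 rel lB.
set A := double_shift x0 y0 in dl0 rel.
set l := tangent_slope x0 y0 in rel lB.
have BE : B = 2 * y0 + ec_a1 E * x0 + ec_a3 E by [].
have AE : A = ec_a2 E - l * ec_a1 E + 3 * x0 - l ^+ 2 by [].
have uE : tate_scale x0 y0 = B / A by [].
have dE : tate_param x0 y0 = - A ^+ 3 / B ^+ 2 by [].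
have cv := fC bas1; rewrite (torsion_mapE fD f_inj p0) /= in cv; move/eqP: cv => cv.
pose u := B / A; pose d := - A ^+ 3 / B ^+ 2.
have u0 : u != 0 by rewrite mulf_neq0 ?invr_eq0.
(* The normal form needs a1 = 1 - d; this is the relation x(3P) = x(-2P), where the order 5 of P
   enters. *)
have h1 : ec_a1 E = u * ec_a1 (tate d) - 2 * l.
  have -> : u * ec_a1 (tate d) = (B ^+ 2 + A ^+ 3) / (A * B).
    by rewrite /u /d /=; field; rewrite dl0 B0.
  have -> : A ^+ 3 = (2 * l + ec_a1 E) * B * A - B ^+ 2.
    have e : - A ^+ 3 = (- A) ^+ 3 by ring.
    by rewrite -[LHS]opprK e rel; ring.
  by field; rewrite dl0 B0.
have h2 : ec_a2 E = u ^+ 2 * ec_a2 (tate d) + l * ec_a1 E - 3 * x0 + l ^+ 2.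
  have -> : u ^+ 2 * ec_a2 (tate d) = A by rewrite /u /d /=; field; rewrite dl0 B0.
  by rewrite AE; ring.
have h3 : ec_a3 E = u ^+ 3 * ec_a3 (tate d) - x0 * ec_a1 E - 2 * y0.
  have -> : u ^+ 3 * ec_a3 (tate d) = B by rewrite /u /d /=; field; rewrite dl0 B0.
  by rewrite BE; ring.
(* The new a4 vanishes because l is the tangent slope, and the new a6 because P is on the curve. *)
have h4 : ec_a4 E = u ^+ 4 * ec_a4 (tate d) + l * ec_a3 E - 2 * x0 * ec_a2 E
  + (y0 + x0 * l) * ec_a1 E - 3 * x0 ^+ 2 + 2 * l * y0.
  transitivity (l * B - (3 * x0 ^+ 2 + 2 * ec_a2 E * x0 - ec_a1 E * y0)).
    by rewrite lB; ring.
  by rewrite BE /=; ring.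
have h6 : ec_a6 E = u ^+ 6 * ec_a6 (tate d) - x0 * ec_a4 E - x0 ^+ 2 * ec_a2 E - x0 ^+ 3
  + y0 * ec_a3 E + y0 ^+ 2 + x0 * y0 * ec_a1 E.
  transitivity ((x0 ^+ 3 + ec_a2 E * x0 ^+ 2 + ec_a4 E * x0 + ec_a6 E)
    - x0 ^+ 3 - ec_a2 E * x0 ^+ 2 - ec_a4 E * x0); first by ring.
  by rewrite -cv /=; ring.
pose g v := change_point u x0 l y0 (f v).
have gD v w : g (v + w) = ec_add (tate d) (g v) (g w).
  by rewrite /g fD (change_add u0 h1 h2 h3 h4).
have g_inj : injective g by move=> v w /(change_point_inj u0)/f_inj.
have gC v : on_curve (tate d) (g v) by apply: (change_on_curve u0 h1 h2 h3 h4 h6).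
have g1 : g bas1 = Some (0, 0).
  by rewrite /g (torsion_mapE fD f_inj p0) /change_point /= !subrr mulr0 subr0 subrr !mul0r.
have g_disc : ec_disc (tate d) != 0.
  by move: disc0; rewrite (change_disc h1 h2 h3 h4 h6) mulf_eq0 negb_or => /andP[].
have gx v : v != 0 -> xcoord g v = (xcoord f v - x0) / u ^+ 2.
  by move=> v0; rewrite /xcoord /g (torsion_mapE fD f_inj v0).
have o2 : off_bas1 bas2 by rewrite /off_bas1 mxE.
split=> [|r].
  rewrite /torsion_sqrt5 uE dE -/d -/u -gx ?off_bas1_neq0 //.
  exact: (tate_velu_sqrt5 gD g_inj gC g1 g_disc o2).
rewrite (change_j u0 h1 h2 h3 h4 h6).
exact: (tate_torsion_quintic_root gD g_inj gC g1 two0 five0 g_disc r).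
Qed.
End NormalForm.

(** * The fibre of the quintic over j(t) *)

Section QuinticFactorization.
Variable F : fieldType.
Implicit Types t S : F.

(* The equation quintic s = j(t) has the rational root fib_root t / fib_den t, and
   splits off two quadratic factors with discriminants -(3t^2+10t+15) and
   -5(3t^2+10t+15) up to squares. *)
Definition fib_den t := (t ^+ 2 + 5 * t + 5) * (t ^+ 4 + 5 * t ^+ 3 + 15 * t ^+ 2 + 25 * t + 25).
Definition fib_root t :=
  5 * t * (4 * t ^+ 4 + 30 * t ^+ 3 + 95 * t ^+ 2 + 150 * t + 100).
Definition fib_p1 t :=
  20 * t ^+ 5 + 150 * t ^+ 4 + 550 * t ^+ 3 + 1125 * t ^+ 2 + 1250 * t + 625.
Definition fib_k1 t := 5 * (2 * t ^+ 2 + 5 * t + 5) * (2 * t ^+ 2 + 10 * t + 15).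
Definition fib_p2 t := 5 * t *
  (t ^+ 5 + 10 * t ^+ 4 + 45 * t ^+ 3 + 110 * t ^+ 2 + 150 * t + 100).
Definition fib_k2 t := t * (t ^+ 2 + 5 * t + 10) * (3 * t ^+ 2 + 10 * t + 10).

Lemma quintic_fiber t S :
  16 * (quintic S * fib_den t ^+ 5 -
   5 ^+ 4 * t ^+ 3 * (t ^+ 2 + 5 * t + 10) ^+ 3
  * (2 * t ^+ 2 + 5 * t + 5) ^+ 3
  * (4 * t ^+ 4 + 30 * t ^+ 3 + 95 * t ^+ 2 + 150 * t + 100) ^+ 3) =
  (fib_den t * S - fib_root t)
  * ((2 * fib_den t * S + fib_p1 t) ^+ 2 + (3 * t ^+ 2 + 10 * t + 15) * fib_k1 t ^+ 2)
  * ((2 * fib_den t * S + fib_p2 t) ^+ 2 + 5 * (3 * t ^+ 2 + 10 * t + 15) * fib_k2 t ^+ 2).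
Proof.
rewrite /quintic /fib_den /fib_root /fib_p1 /fib_p2 /fib_k1 /fib_k2; ring.
Qed.
End QuinticFactorization.

(** The two sides have 5-adic valuations of different parity. *)
Lemma rat_sqr_neq5 (x : rat) : x ^+ 2 != 5.
Proof.
apply/negP => /eqP e.
have d0 : (denq x)%:~R != 0 :> rat by rewrite intr_eq0 denq_eq0.
have en : (numq x)%:~R ^+ 2 = 5 * (denq x)%:~R ^+ 2 :> rat.
  by rewrite -e -[X in _ = X ^+ 2 * _]divq_num_den expr_div_n divfK ?expf_neq0.
have {}en : numq x ^+ 2 = 5%N%:Z * denq x ^+ 2.
  by apply: (@intr_inj rat); rewrite [RHS]rmorphM !rmorphXn /= en.
move/(congr1 absz): en; rewrite abszM !abszX => /(congr1 (logn 5)).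
have dp : (0 < `|denq x|)%N by rewrite absz_gt0 denq_eq0.
rewrite lognX lognM ?expn_gt0 ?dp // lognX => /(congr1 odd).
by rewrite oddD !oddM.
Qed.

Section FiberMorphism.
Variables (K L : fieldType) (f : {rmorphism K -> L}) (t : K).
Let rmE := (rmorph_nat f, rmorphXn f, rmorphM f, rmorphD f, rmorphN f, fmorph_div f).

Lemma rmorph_fib_den : f (fib_den t) = fib_den (f t).
Proof. by rewrite /fib_den !rmE. Qed.
Lemma rmorph_fib_root : f (fib_root t) = fib_root (f t).
Proof. by rewrite /fib_root !rmE. Qed.
Lemma rmorph_fib_k1 : f (fib_k1 t) = fib_k1 (f t).
Proof. by rewrite /fib_k1 !rmE. Qed.
Lemma rmorph_fib_k2 : f (fib_k2 t) = fib_k2 (f t).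
Proof. by rewrite /fib_k2 !rmE. Qed.
Lemma rmorph_fib_disc : f (3 * t ^+ 2 + 10 * t + 15) = 3 * f t ^+ 2 + 10 * f t + 15.
Proof. by rewrite !rmE. Qed.
Lemma rmorph_fib_num : f (5 ^+ 4 * t ^+ 3 * (t ^+ 2 + 5 * t + 10) ^+ 3
  * (2 * t ^+ 2 + 5 * t + 5) ^+ 3
  * (4 * t ^+ 4 + 30 * t ^+ 3 + 95 * t ^+ 2 + 150 * t + 100) ^+ 3) =
  5 ^+ 4 * f t ^+ 3 * (f t ^+ 2 + 5 * f t + 10) ^+ 3
  * (2 * f t ^+ 2 + 5 * f t + 5) ^+ 3
  * (4 * f t ^+ 4 + 30 * f t ^+ 3 + 95 * f t ^+ 2 + 150 * f t + 100) ^+ 3.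
Proof. by rewrite !rmE. Qed.
End FiberMorphism.

Section FiberPositivity.
Variables (R : realFieldType) (t : R).

Lemma quadratic_gt0 (a b c : R) : 0 < a -> b ^+ 2 < 4 * a * c ->
  0 < a * t ^+ 2 + b * t + c.
Proof.
move=> a0 d0; rewrite -(pmulr_rgt0 _ (mulr_gt0 (ltr0Sn _ 3) a0)).
have -> : 4 * a * (a * t ^+ 2 + b * t + c) = (2 * a * t + b) ^+ 2 + (4 * a * c - b ^+ 2) by ring.
by rewrite ltr_wpDl ?sqr_ge0 // subr_gt0.
Qed.

Lemma fib_disc_gt0 : 0 < 3 * t ^+ 2 + 10 * t + 15.
Proof. by apply: quadratic_gt0; lra. Qed.

Lemma fib_k1_neq0 : fib_k1 t != 0.
Proof.
by rewrite /fib_k1 !mulf_neq0 ?pnatr_eq0 //; apply: lt0r_neq0; apply: quadratic_gt0; lra.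
Qed.
Lemma fib_k2_neq0 : t != 0 -> fib_k2 t != 0.
Proof.
move=> t0; rewrite /fib_k2 !mulf_neq0 //; apply: lt0r_neq0.
  by rewrite -[t ^+ 2]mul1r; apply: quadratic_gt0; lra.
by apply: quadratic_gt0; lra.
Qed.

(** The quadratic factor satisfies 4 (t^2 + 5 t + 5) = (2 t + 5)^2 - 5; the quartic one is a square
    plus a positive definite quadratic. *)
Lemma fib_den_neq0 : (2 * t + 5) ^+ 2 != 5 -> fib_den t != 0.
Proof.
move=> t5; rewrite /fib_den mulf_neq0 //.
  apply: contraNneq t5 => e.
  apply/eqP; transitivity (4 * (t ^+ 2 + 5 * t + 5) + 5); first by ring.
  by rewrite e mulr0 add0r.
have -> : t ^+ 4 + 5 * t ^+ 3 + 15 * t ^+ 2 + 25 * t + 25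
  = (t ^+ 2 + 5 / 2 * t + 3) ^+ 2 + (11 / 4 * t ^+ 2 + 10 * t + 16) by field.
by apply: lt0r_neq0; apply: ltr_wpDl; [exact: sqr_ge0 | apply: quadratic_gt0; lra].
Qed.
End FiberPositivity.

(** As z is not the rational root, one of the two quadratic factors of [quintic_fiber] vanishes at
    z. Either gives the square root, the second after division by [s5]. *)
Lemma sqrt_of_quintic_root (K : realFieldType) (L : fieldType)
    (f : {rmorphism K -> L}) (j t : K) (s5 z : L) :
  (2 * t + 5) ^+ 2 != 5 ->
  j * fib_den t ^+ 5 = 5 ^+ 4 * t ^+ 3 * (t ^+ 2 + 5 * t + 10) ^+ 3
  * (2 * t ^+ 2 + 5 * t + 5) ^+ 3
  * (4 * t ^+ 4 + 30 * t ^+ 3 + 95 * t ^+ 2 + 150 * t + 100) ^+ 3 ->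
  s5 ^+ 2 = 5 -> quintic z = f j -> z != f (fib_root t / fib_den t) ->
  exists s1 : L, s1 ^+ 2 = f (- (3 * t ^+ 2 + 10 * t + 15)).
Proof.
move=> t5 jE s52 zj zr.
have den0 := fib_den_neq0 t5.
have D0 : fib_den (f t) != 0 by rewrite -rmorph_fib_den fmorph_eq0.
have k1_0 : fib_k1 (f t) != 0 by rewrite -rmorph_fib_k1 fmorph_eq0 fib_k1_neq0.
have zr' : fib_den (f t) * z - fib_root (f t) != 0.
  apply: contraNneq zr => /eqP; rewrite subr_eq0 => /eqP e.
  rewrite fmorph_div rmorph_fib_den rmorph_fib_root; apply/eqP/(mulfI D0).
  by rewrite e mulrC divfK.
rewrite rmorphN rmorph_fib_disc.
have := quintic_fiber (f t) z.
have -> : quintic z * fib_den (f t) ^+ 5 = f (j * fib_den t ^+ 5).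
  by rewrite zj rmorphM rmorphXn rmorph_fib_den.
rewrite jE rmorph_fib_num.
rewrite subrr mulr0 => /esym/eqP; rewrite mulf_eq0 mulf_eq0 (negPf zr') /=.
have s50 : s5 != 0.
  apply/negP => /eqP s0; move: s52; rewrite s0 expr0n /= => /eqP.
  by rewrite eq_sym -(rmorph_nat f 5) fmorph_eq0 pnatr_eq0.
rewrite !addr_eq0; set T := f t in D0 k1_0 zr' *.
set D := 3 * T ^+ 2 + 10 * T + 15.
case/orP => /eqP e.
  by exists ((2 * fib_den T * z + fib_p1 T) / fib_k1 T); rewrite expr_div_n e; field.
(* At t = 0 [fib_k2] vanishes, but then the second factor forces z = 0, which is the excluded
   rational root. *)
have [t0|t0] := eqVneq t 0.
  case/eqP: zr'.
  have T0 : T = 0 by rewrite /T t0 rmorph0.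
  have p0 : fib_p2 T = 0 by rewrite /fib_p2 T0 mulr0 mul0r.
  have k0 : fib_k2 T = 0 by rewrite /fib_k2 T0 !mul0r.
  have r0 : fib_root T = 0 by rewrite /fib_root T0 mulr0 !mul0r.
  move: e; rewrite p0 k0 r0 addr0 subr0 expr0n /= mulr0 oppr0 => /eqP.
  rewrite expf_eq0 /= -mulrA mulf_eq0.
  have /negbTE -> : (2 : L) != 0 by rewrite -(rmorph_nat f 2) fmorph_eq0 pnatr_eq0.
  by move=> /eqP.
have k2_0 : fib_k2 T != 0 by rewrite -rmorph_fib_k2 fmorph_eq0 fib_k2_neq0.
exists ((2 * fib_den T * z + fib_p2 T) / (s5 * fib_k2 T)).
rewrite expr_div_n e [X in _ / X]exprMn s52; field.
by rewrite k2_0 -(rmorph_nat f 5) fmorph_eq0 pnatr_eq0.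
Qed.

(** * Index two subgroups and induced representations *)

Section IndexTwo.
Variables (gT : finGroupType) (G : {group gT}).
Implicit Types H : {group gT}.
Local Open Scope group_scope.

Lemma index2_memM H g h : H \subset G -> #|G : H| = 2 -> g \in G -> h \in G ->
  (g * h \in H) = ((g \in H) == (h \in H)).
Proof.
move=> sHG iH Gg Gh.
have [Hg|nHg] := boolP (g \in H); first by rewrite groupMl // eq_sym; case: (h \in H).
have [Hh|nHh] := boolP (h \in H); first by rewrite groupMr // (negPf nHg).
rewrite eqxx; apply: contraT => nHgh.
have u3 : uniq [:: H :* 1; H :* g; H :* h^-1].
  rewrite /= !inE !andbT negb_or -andbA; apply/and3P; split.
  - by apply: contra nHg => /eqP/rcoset_eqP; rewrite mem_rcoset mul1g groupV.
  - by apply: contra nHh => /eqP/rcoset_eqP; rewrite mem_rcoset mul1g invgK.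
  by apply: contra nHgh => /eqP/rcoset_eqP; rewrite mem_rcoset invgK.
suff : (size [:: H :* 1; H :* g; H :* h^-1] <= size (enum (rcosets H G)))%N.
  by rewrite -cardE -/(#|G : H|) iH.
apply: uniq_leq_size u3 _ => A; rewrite !inE mem_enum.
by case/or3P => /eqP ->; rewrite mem_rcosets mulSGid // ?group1 ?groupV.
Qed.

(** Membership in a subgroup of index 2 is a homomorphism to Z/2, so the elements on which two such
    memberships agree form a subgroup. *)
Lemma index2_eq H1 H2 x y : G :=: <<[set x; y]>> ->
  H1 \subset G -> #|G : H1| = 2 -> H2 \subset G -> #|G : H2| = 2 ->
  (x \in H1) = (x \in H2) -> (y \in H1) = (y \in H2) -> H1 :=: H2.
Proof.
move=> defG s1 i1 s2 i2 ex ey.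
have Gx : x \in G by rewrite defG mem_gen // !inE eqxx.
have Gy : y \in G by rewrite defG mem_gen // !inE eqxx orbT.
pose S := [set g in G | (g \in H1) == (g \in H2)].
have gS : group_set S.
  apply/group_setP; split=> [|g h]; first by rewrite !inE !group1.
  rewrite !inE => /andP[Gg /eqP eg] /andP[Gh /eqP eh].
  by rewrite groupM // !index2_memM // eg eh /=.
have sGS : G \subset Group gS.
  by rewrite defG gen_subG; apply/subsetP=> z /set2P[] ->; rewrite !inE ?Gx ?Gy ?ex ?ey eqxx.
apply/setP=> g; have [Gg|nGg] := boolP (g \in G).
  by have := subsetP sGS g Gg; rewrite inE => /andP[_ /eqP].
by rewrite !(contraNF (subsetP _ g) nGg).
Qed.

Lemma index2_neither x y H : G :=: <<[set x; y]>> -> H \subset G -> #|G : H| = 2 ->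
  (x \in H) && (y \in H) = false.
Proof.
move=> defG sHG iH; apply/negP => /andP[Hx Hy].
have: G \subset H by rewrite defG gen_subG; apply/subsetP => z /set2P[] ->.
by move=> sGH; move: iH; rewrite -indexgI (setIidPl sGH) indexgg.
Qed.

Section ThreeSubgroups.
Variables (x y : gT) (H1 H2 H3 : {group gT}).
Hypothesis defG : G :=: <<[set x; y]>>.
Hypotheses (s1 : H1 \subset G) (s2 : H2 \subset G) (s3 : H3 \subset G).
Hypotheses (i1 : #|G : H1| = 2) (i2 : #|G : H2| = 2) (i3 : #|G : H3| = 2).
Hypotheses (n12 : H1 :!=: H2) (n13 : H1 :!=: H3) (n23 : H2 :!=: H3).
Hypothesis H3y : y \in H3.

(** A subgroup of index 2 is determined by which of x and y it contains, and cannot contain both.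
    The three remaining patterns are shared among [H1], [H2] and [H3], and only one of them contains
    y. *)
Lemma index2_triple :
  [/\ y \notin H1, y \notin H2, x \notin H3 & (x \in H1) = (x \notin H2)].
Proof.
have e12 := index2_eq defG s1 i1 s2 i2; have e13 := index2_eq defG s1 i1 s3 i3.
have e23 := index2_eq defG s2 i2 s3 i3.
have := index2_neither defG s1 i1; have := index2_neither defG s2 i2.
have := index2_neither defG s3 i3; rewrite H3y andbT => x3.
move: n12 n13 n23 => /eqP m12 /eqP m13 /eqP m23; move: e12 e13 e23; rewrite H3y x3.
case: (x \in H1) (x \in H2) (y \in H1) (y \in H2) => [] [] [] [] // e12 e13 e23 _ _;
  by [case: m12; exact: e12 | case: m13; exact: e13 | case: m23; exact: e23].
Qed.

Lemma index2_exhaust (K : {group gT}) : K \subset G -> #|G : K| = 2 ->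
  [\/ K :=: H1, K :=: H3 | K :=: H2].
Proof.
move=> sK iK; have [y1 y2 x3 x12] := index2_triple.
have e1 := index2_eq defG sK iK s1 i1; have e2 := index2_eq defG sK iK s2 i2.
have e3 := index2_eq defG sK iK s3 i3; have := index2_neither defG sK iK.
move: e1 e2 e3; rewrite H3y x12 (negPf y1) (negPf y2) (negPf x3).
case: (x \in K) (y \in K) (x \in H2) => [] [] [] // e1 e2 e3 _;
  by [apply: Or31; exact: e1 | apply: Or32; exact: e3 | apply: Or33; exact: e2].
Qed.
End ThreeSubgroups.
End IndexTwo.

Section InvolutionExtension.
Variable gT : finGroupType.
Local Open Scope group_scope.

(** As b normalises <c>, the group is the product of <c> and <b>. It bounds the order of [G16]
    without computing those of a and ab. *)
Lemma card_gen_involution (c b : gT) : b * b = 1 -> b * c * b \in <[c]> ->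
  (#|<<[set c; b]>>| <= 2 * #|<[c]>|)%N.
Proof.
move=> bb nb; have bV : b^-1 = b by apply/eqP; rewrite eq_invg_mul bb.
have nbc : <[b]> \subset 'N(<[c]>).
  by rewrite cycle_subG inE -cycleJ cycle_subG conjgE bV mulgA.
have ob : (#|<[b]>| <= 2)%N by rewrite dvdn_leq // order_dvdn expgS expg1 bb.
have -> : <<[set c; b]>> = <[c]> * <[b]>.
  by rewrite -(norm_joinEr nbc) joing_idl joing_idr.
rewrite mulnC (leq_trans _ (leq_mul (leqnn _) ob)) //.
by rewrite mul_cardG leq_pmulr // cardG_gt0.
Qed.

Lemma conj_gen2 (a b y : gT) : a ^ y \in <<[set a; b]>> -> b ^ y \in <<[set a; b]>> ->
  <<[set a; b]>> :^ y = <<[set a; b]>>.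
Proof.
move=> ay yb; apply/eqP; rewrite eqEcard cardJg leqnn andbT -genJ gen_subG.
apply/subsetP => z; rewrite mem_conjg => /set2P[] e; rewrite -[z](conjgKV y) e //.
Qed.

Lemma morphim_conj (rT : finGroupType) (G : {group gT}) (f g : {morphism G >-> rT}) y :
  (forall x, x \in G -> g x = f x ^ y) -> g @* G = (f @* G) :^ y.
Proof.
move=> fg; apply/setP => z; rewrite mem_conjg.
apply/morphimP/morphimP => -[x Gx _ e]; exists x => //.
  by rewrite e fg // conjgK.
by rewrite fg // -e conjgKV.
Qed.

Lemma gen2_mul (a b : gT) : b * b = 1 -> <<[set a; b]>> = <<[set a * b; b]>>.
Proof.
move=> bb; set S := [set a * b; b].
have Sab : a * b \in <<S>> by rewrite mem_gen // !inE eqxx.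
have Sb : b \in <<S>> by rewrite mem_gen // !inE eqxx orbT.
have Sa : a \in <<S>> by have := groupM Sab Sb; rewrite -[X in X \in _]mulgA bb mulg1.
have Ta : a \in <<[set a; b]>> by rewrite mem_gen // !inE eqxx.
have Tb : b \in <<[set a; b]>> by rewrite mem_gen // !inE eqxx orbT.
apply/eqP; rewrite eqEsubset !gen_subG; apply/andP; split; apply/subsetP => z /set2P[] -> //.
exact: groupM.
Qed.
End InvolutionExtension.

Section EigenCharacter.
Variables (F : fieldType) (gT : finGroupType) (G : {group gT}) (n : nat).
Variables (rG : mx_representation F G n) (w : 'rV[F]_n) (j : 'I_n).
Hypothesis wj : w 0 j = 1.
Hypothesis w_eigen : forall g, g \in G -> exists c, w *m rG g = c *: w.

(** Since w has j-th coordinate 1, this entry is the eigenvalue of g on w. *)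
Definition eigen_mx (g : gT) : 'M[F]_1 := ((w *m rG g) 0 j)%:M.

Lemma eigen_mxE g : g \in G -> w *m rG g = (w *m rG g) 0 j *: w.
Proof. by move=> /w_eigen[c ->]; rewrite mxE wj mulr1. Qed.

Lemma eigen_mx_repr : mx_repr G eigen_mx.
Proof.
split=> [|g h Gg Gh]; first by rewrite /eigen_mx repr_mx1 mulmx1 wj.
have e : w *m rG (g * h)%g = ((w *m rG g) 0 j * (w *m rG h) 0 j) *: w.
  by rewrite repr_mxM // mulmxA {1}(eigen_mxE Gg) -scalemxAl {1}(eigen_mxE Gh) scalerA.
by rewrite /eigen_mx e [((_ * _) *: w) 0 j]mxE wj mulr1 scalar_mxM.
Qed.

Definition eigen_repr := MxRepresentation eigen_mx_repr.
End EigenCharacter.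

(** * Frobenius reciprocity in index two *)

Section FrobeniusReciprocity.
Variables (F : fieldType) (gT : finGroupType) (G H : {group gT}).
Hypotheses (sHG : H \subset G) (iH : #|G : H| = 2).
Variables (rG : mx_representation F G 2) (rH : mx_representation F H 1).
Variable w : 'rV[F]_2.
Hypothesis w_eigen : forall h, h \in H -> w *m rG h = rH h *m w.
Variable g : gT.
Hypothesis Gg : g \in G.
Hypothesis w_gen : forall v : 'rV[F]_2, exists c d, v = c *: w + d *: (w *m rG g).

(** The matrix with rows w t_i, for the coset representatives t_i, intertwines the two
    representations. Its row space contains the orbit of w, hence everything, and both dimensions
    are 2. *)
Lemma induced_rsim : mx_rsim (induced_repr sHG rH) rG.
Proof.
pose C i := w *m rG (transv (G := G) (H := H) i).
pose B : 'M[F]_(\sum_(i < #|G : H|) 1, 2) := \mxcol_(i < #|G : H|) C i.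
have cosetB i h : h \in H -> w *m rG (h * transv (G := G) i)%g = rH h *m C i.
  move=> Hh; have Gh := subsetP sHG h Hh; have Gt := transv_in sHG i.
  rewrite (repr_mxM _ Gh Gt) mulmxA w_eigen //.
  by rewrite /C mulmxA.
have subB x : x \in G -> (w *m rG x <= B)%MS.
  move=> Gx; have [i Hi] := transv_ex H Gx.
  rewrite -[x](mulgKV (transv i)) cosetB // mulmx_sub //.
  by rewrite eqmx_col (sumsmx_sup i) // genmxE.
have szB : (\sum_(i < #|G : H|) 1 = 2)%N by rewrite sum1_card card_ord.
have rkB : \rank B = 2.
  apply/eqP; rewrite -[_ == _]/(row_full B) -sub1mx; apply/row_subP => i.
  have [c [d ->]] := w_gen (row i 1%:M).
  rewrite addmx_sub // scalemx_sub ?subB //.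
  by rewrite -[w]mulmx1 -(repr_mx1 rG) subB.
exists B => //; first by rewrite /row_free rkB szB.
move=> x Gx; rewrite /= /induced_mx mul_mxblock_mxrow mxcol_mul.
apply: eq_mxcol => i.
have [k Hk] := transv_ex H (groupM (transv_in sHG i) Gx).
rewrite (bigD1 k) //= Hk big1 => [|k' ne_k].
  rewrite addr0 -cosetB // mulgKV repr_mxM ?(transv_in sHG) // mulmxA.
  by [].
case: ifP => Hk'; last by rewrite mul0mx.
case/eqP: ne_k; apply: (transv_inj (H := H) (G := G)).
by rewrite -(groupMl _ Hk') mulgA mulgKV.
Qed.
End FrobeniusReciprocity.

(** * The group G16 *)

Lemma mul_mx2 (R : pzRingType) (x y z w x' y' z' w' : R) :
  mx2 x y z w *m mx2 x' y' z' w' =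
  mx2 (x * x' + y * z') (x * y' + y * w') (z * x' + w * z') (z * y' + w * w').
Proof.
apply/matrixP=> i j; rewrite !mxE !big_ord_recl big_ord0 !mxE addr0.
by case: i j => [[|[|i]] ?] [[|[|j]] ?].
Qed.

Lemma row_mul_mx2 (R : pzRingType) (v : 'rV[R]_2) x y z w :
  v *m mx2 x y z w = \row_j (if j == 0 then v 0 0 * x + v 0 1 * z else v 0 0 * y + v 0 1 * w).
Proof.
apply/rowP=> j; rewrite !mxE !big_ord_recl big_ord0 !mxE addr0.
have -> : lift ord0 ord0 = 1 :> 'I_2 by apply: val_inj.
by case: j => [[|[|j]] ?].
Qed.

Lemma GLmulE (u v : {'GL_2['F_5]}) : val (u * v)%g = val u *m val v.
Proof. by []. Qed.

Local Ltac mx2_compute :=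
  apply: val_inj; rewrite !GLmulE /= /mx_a /mx_b !mul_mx2; congr mx2; apply: val_inj.

Lemma gl_b_sqr : (gl_b * gl_b = 1)%g.
Proof.
apply: val_inj; rewrite GLmulE /= /mx_b mul_mx2; apply/matrixP => i j; rewrite !mxE.
by case: i j => [[|[|i]] ?] [[|[|j]] ?] //; apply: val_inj.
Qed.

Lemma gl_a_conj_b : (gl_b * gl_a * gl_b = gl_a * (gl_a * (gl_a * (gl_a * gl_a))))%g.
Proof. by rewrite -!mulgA; mx2_compute. Qed.

Lemma gl_ab_conj_b : let c := (gl_a * gl_b)%g in
  (gl_b * c * gl_b = c * (c * (c * (c * c))))%g.
Proof. by move=> c; rewrite /c -!mulgA; mx2_compute. Qed.

Lemma gl_a_G16 : gl_a \in G16.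
Proof. exact/mem_gen/set21. Qed.

Lemma gl_b_G16 : gl_b \in G16.
Proof. exact/mem_gen/set22. Qed.

Lemma card_G16_a : (#|G16| <= 2 * #|<[gl_a]>%g|)%N.
Proof.
apply: (card_gen_involution gl_b_sqr); rewrite gl_a_conj_b.
by move: gl_a (cycle_id gl_a) => c cc; rewrite !groupM.
Qed.

Lemma card_G16_ab : (#|G16| <= 2 * #|<[(gl_a * gl_b)%g]>%g|)%N.
Proof.
rewrite /= (gen2_mul gl_a gl_b_sqr); apply: (card_gen_involution gl_b_sqr).
rewrite gl_ab_conj_b.
by move: (gl_a * gl_b)%g (cycle_id (gl_a * gl_b)%g) => c cc; rewrite !groupM.
Qed.

(* diag(1, 2) normalises G16, fixing b and exchanging <a> and <ab>. *)
Definition mx_n : 'M['F_5]_2 := mx2 1 0 0 2.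
Definition mx_n' : 'M['F_5]_2 := mx2 1 0 0 3.

Local Ltac mx1_compute :=
  apply/matrixP; case=> [[|[|?]] ?]; case=> [[|[|?]] ?]; rewrite // !mxE; apply: val_inj.

Lemma mx_nK : mx_n *m mx_n' = 1%:M.
Proof. by rewrite mul_mx2; mx1_compute. Qed.

Lemma mx_n_unit : mx_n \in unitmx.
Proof. exact: (mulmx1_unit mx_nK).1. Qed.

Lemma invmx_n : invmx mx_n = mx_n'.
Proof. by rewrite -[LHS]mulmx1 -mx_nK mulmxA mulVmx ?mx_n_unit // mul1mx. Qed.

Lemma mx_n_conj_b : mx_n *m mx_b *m invmx mx_n = mx_b.
Proof. by rewrite invmx_n !mul_mx2; congr mx2; apply: val_inj. Qed.

Lemma mx_n_conj_a : mx_n *m mx_a *m invmx mx_n =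
  mx_a *m mx_b *m (mx_a *m mx_b *m (mx_a *m mx_b)).
Proof. by rewrite invmx_n !mul_mx2; congr mx2; apply: val_inj. Qed.

(** The conjugate of ab is the inverse of a, which has order 8; hence the seventh power. *)
Lemma mx_n_conj_ab : let c := mx_n *m (mx_a *m mx_b) *m invmx mx_n in
  c *m (c *m (c *m (c *m (c *m (c *m c))))) = mx_a.
Proof. by move=> c; rewrite /c invmx_n !mul_mx2; congr mx2; apply: val_inj. Qed.

Lemma bas1_mx_b (v : 'rV['F_5]_2) : v = delta_mx 0 0 -> v *m mx_b = - v.
Proof.
move=> ->; rewrite row_mul_mx2; apply/rowP=> j; rewrite !mxE.
by case: j => [[|[|j]] ?] //; apply: val_inj.
Qed.

Lemma bas2_mx_b (v : 'rV['F_5]_2) : v = delta_mx 0 1 -> v *m mx_b = v.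
Proof.
move=> ->; rewrite row_mul_mx2; apply/rowP=> j; rewrite !mxE.
by case: j => [[|[|j]] ?] //; apply: val_inj.
Qed.

(** * Descent to the division field *)

Section CurveMorphism.
Variables (K L : fieldType) (g : {rmorphism K -> L}) (E : weierstrass K).
Let rmE := (rmorph_nat g, rmorphXn g, rmorphB g, rmorphN g, rmorphM g, rmorphD g,
  fmorph_div g, fmorphV g, rmorph1 g, rmorph0 g).
Local Notation gE := (map_curve g E).

Lemma map_point_inj : injective (map_point g).
Proof.
by case=> [[x y]|] [[x' y']|] //= [] /fmorph_inj -> /fmorph_inj ->.
Qed.

Lemma map_on_curve P : on_curve gE (map_point g P) = on_curve E P.
Proof. by case: P => [[x y]|] //=; rewrite -(fmorph_eq g) !rmE. Qed.

Lemma map_ec_add P Q :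
  map_point g (ec_add E P Q) = ec_add gE (map_point g P) (map_point g Q).
Proof.
case: P Q => [[x y]|] [[x' y']|] //=.
rewrite (fmorph_eq g) -[X in g y' == X](_ : g (- y - ec_a1 E * x - ec_a3 E) = _); last first.
  by rewrite !rmE.
rewrite (fmorph_eq g); case: ifP => //= _.
by case: ifP => _; rewrite /map_point /= !rmE.
Qed.

Lemma map_ec_disc : ec_disc gE = g (ec_disc E).
Proof. by rewrite /ec_disc /ec_b2 /ec_b4 /ec_b6 /ec_b8 /= !rmE. Qed.

Lemma map_ec_j : ec_j gE = g (ec_j E).
Proof.
rewrite /ec_j map_ec_disc fmorph_div; congr (_ / _).
by rewrite /ec_c4 /ec_b2 /ec_b4 /= !rmE.
Qed.

Lemma map_torsion_sqrt5 x0 y0 x :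
  torsion_sqrt5 gE (g x0) (g y0) (g x) = g (torsion_sqrt5 E x0 y0 x).
Proof.
have eB : tangent_den gE (g x0) (g y0) = g (tangent_den E x0 y0).
  by rewrite /tangent_den /= !rmE.
have el : tangent_slope gE (g x0) (g y0) = g (tangent_slope E x0 y0).
  by rewrite /tangent_slope eB /= fmorph_div !rmE.
have eA : double_shift gE (g x0) (g y0) = g (double_shift E x0 y0).
  by rewrite /double_shift el /= !rmE.
have ed : tate_param gE (g x0) (g y0) = g (tate_param E x0 y0).
  by rewrite /tate_param eA eB !rmE.
have eu : (g x - g x0) / tate_scale gE (g x0) (g y0) ^+ 2 =
    g ((x - x0) / tate_scale E x0 y0 ^+ 2).
  by rewrite /tate_scale eA eB !rmE.
rewrite /torsion_sqrt5 ed eu /velu_sqrt5 /velu_num /velu_den.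
by move: (tate_param E x0 y0) ((x - x0) / _) => d z; rewrite !rmE.
Qed.
End CurveMorphism.

Section DivisionField.
Variables (E : weierstrass rat) (L : splittingFieldType rat) (iota : {rmorphism L -> algC}).
Hypothesis L_def : division_field E 5 iota.
Variables (e : 'rV['F_5]_2 -> point algC) (rho : mx_representation 'F_5 'Gal({:L} / 1) 2).
Hypotheses (e_basis : torsion5_basis E e) (rho_def : torsion5_repr iota e rho).

Let EL : weierstrass L := map_curve (in_alg L) E.

Lemma map_curve_ratr : map_curve ratr E = map_curve iota EL.
Proof.
have h x : ratr x = iota (in_alg L x) :> algC.
  by rewrite -(fmorph_eq_rat (iota \o in_alg L)).
by rewrite /EL /map_curve /= !h.
Qed.

Lemma torsion_point_descent P : torsion (map_curve ratr E) 5 P ->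
  exists Q : point L, map_point iota Q == P.
Proof.
have [s _ sP] := L_def; case: P => [[x y]|] tP; last by exists None.
have /mapP[x' _ ->] : x \in map iota s by apply/sP; exists (x, y); split=> //; left.
have /mapP[y' _ ->] : y \in map iota s by apply/sP; exists (x, y); split=> //; right.
by exists (Some (x', y')).
Qed.

Lemma torsion_basis_descent v : exists Q : point L, map_point iota Q == e v.
Proof.
by have [_ _ eT] := e_basis; apply: torsion_point_descent; apply/eT; exists v.
Qed.

(** Pulling the points back to L allows the preceding algebra to be done over L, where the Galois
    group acts on coordinates. *)
Definition torsion_descent v : point L := xchoose (torsion_basis_descent v).

Lemma torsion_descentE v : map_point iota (torsion_descent v) = e v.
Proof. exact/eqP/(xchooseP (torsion_basis_descent v)). Qed.

Lemma torsion_descentD u v :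
  torsion_descent (u + v) = ec_add EL (torsion_descent u) (torsion_descent v).
Proof.
have [eD _ _] := e_basis; apply: (@map_point_inj _ _ iota).
by rewrite map_ec_add !torsion_descentE eD map_curve_ratr.
Qed.

Lemma torsion_descent_inj : injective torsion_descent.
Proof.
have [_ e_inj _] := e_basis => u v euv; apply: e_inj.
by rewrite -!torsion_descentE euv.
Qed.

Lemma torsion_descent_on_curve v : on_curve EL (torsion_descent v).
Proof.
have [_ _ eT] := e_basis.
rewrite -(map_on_curve iota) torsion_descentE -map_curve_ratr.
by have /andP[] : torsion (map_curve ratr E) 5 (e v) by apply/eT; exists v.
Qed.

Lemma torsion_descent_gal sigma v : sigma \in 'Gal({:L} / 1) ->
  map_point sigma (torsion_descent v) = torsion_descent (v *m rho sigma).
Proof.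
move=> Gs; apply: (@map_point_inj _ _ iota).
by rewrite torsion_descentE; apply: rho_def => //; rewrite torsion_descentE.
Qed.

(** Such a sigma fixes every coordinate of a 5-torsion point, and these generate L. *)
Lemma torsion_repr_faithful sigma : sigma \in 'Gal({:L} / 1) -> rho sigma = 1%:M -> sigma = 1%g.
Proof.
move=> Gs r1; have [s sfull sP] := L_def.
have fix_s z : z \in s -> sigma z = z.
  move=> sz; have /sP[[x y] [tP zE]] : iota z \in map iota s by apply: map_f.
  have [_ _ eT] := e_basis; have /eT[v ev] := tP.
  have := torsion_descent_gal v Gs; rewrite r1 mulmx1.
  have := torsion_descentE v; rewrite ev; case: (torsion_descent v) => [[x' y']|] //=.
  by case=> ex ey [sx sy]; case: zE => /=; rewrite -?ex -?ey => /fmorph_inj ->.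
apply/eqP/gal_eqP => a _; rewrite gal_id.
have : (<<1 & s>> <= fixedField [set sigma])%VS.
  apply/Fadjoin_seqP; split; first exact: sub1v.
  by move=> z /fix_s sz; apply/fixedFieldP; rewrite ?memvf // => x /set1P ->.
rewrite sfull => /subvP/(_ a (memvf a))/(fixedFieldP (memvf a)); apply.
exact: set11.
Qed.

(** The matrix [mx_b] sends the basis (P, Q) to (-P, Q), and [torsion_sqrt5] is even in P. *)
Lemma torsion_sqrt5_fixed beta : beta \in 'Gal({:L} / 1) -> rho beta = mx_b ->
  ec_disc E != 0 ->
  exists s5 : L, [/\ s5 ^+ 2 = 5, beta s5 = s5 &
    forall r, exists2 z : L, quintic z = in_alg L (ec_j E) & z != r].
Proof.
move=> Gb rb disc0; pose f := torsion_descent.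
have two0 : (2 : L) != 0 by rewrite -(rmorph_nat (in_alg L) 2) fmorph_eq0 pnatr_eq0.
have five0 : (5 : L) != 0 by rewrite -(rmorph_nat (in_alg L) 5) fmorph_eq0 pnatr_eq0.
have discL : ec_disc EL != 0 by rewrite map_ec_disc fmorph_eq0.
have [s5E root] := torsion_normal_form torsion_descentD torsion_descent_inj
   torsion_descent_on_curve two0 five0 discL.
have p0 := bas1_neq0.
have q0 : bas2 != 0 by apply: (off_bas1_neq0 (v := bas2)); rewrite /off_bas1 mxE.
have f1 : f bas1 = Some (xcoord f bas1, ycoord f bas1).
  exact: (torsion_mapE torsion_descentD torsion_descent_inj p0).
have f2 : f bas2 = Some (xcoord f bas2, ycoord f bas2).
  exact: (torsion_mapE torsion_descentD torsion_descent_inj q0).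
have := torsion_descent_gal bas1 Gb; rewrite rb bas1_mx_b //.
rewrite (torsion_mapN torsion_descentD) -/f f1 /= => -[bx1 by1].
have := torsion_descent_gal bas2 Gb; rewrite rb bas2_mx_b // -/f f2 /= => -[bx2 _].
eexists; split; [exact: s5E | | ]; last by move=> r; have := root r; rewrite map_ec_j.
rewrite -map_torsion_sqrt5 -/f /= bx1 by1 bx2.
have -> : map_curve beta EL = EL.
  by rewrite /EL /map_curve /= !linearZ /= !rmorph1.
by apply: torsion_sqrt5_neg; apply: (torsion_map_tangent_neq0 torsion_descentD torsion_descent_inj).
Qed.
End DivisionField.

(** * Quadratic subfields *)

Section QuadraticSubfields.
Variable L : splittingFieldType rat.
Implicit Types (K : {subfield L}) (x y : L).
Local Notation GalL := 'Gal({:L} / 1).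

Lemma galois_over_rat K : galois K {:L}.
Proof.
rewrite /galois subvf normalFieldf andbT; apply/separableP => x _.
by apply: pcharf0_separable => p; rewrite (fmorph_pchar (in_alg L)) pchar_num.
Qed.

Lemma gal_index K : #|GalL : 'Gal({:L} / K)| = \dim K.
Proof.
have g1 := galois_over_rat 1%AS; have gK := galois_over_rat K.
rewrite -(dim_fixed_galois g1 (galS _ (sub1v K))).
have /galois_fixedField -> := gK.
by rewrite dimv1 divn1.
Qed.

Lemma gal_inj K K' : 'Gal({:L} / K) = 'Gal({:L} / K') -> K = K'.
Proof.
move=> e; apply: val_inj => /=.
by have /galois_fixedField <- := galois_over_rat K; have /galois_fixedField <- := galois_over_rat K'; rewrite e.
Qed.

Lemma mem_gal_adjoin x sigma : sigma \in GalL ->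
  (sigma \in 'Gal({:L} / <<1; x>>)) = (sigma x == x).
Proof.
move=> Gs; apply/idP/eqP => [h|sx].
  by apply: (fixed_gal (subvf _) h); apply: memv_adjoin.
have : ([set sigma] \subset 'Gal({:L} / <<1; x>>)).
  rewrite (galois_connection _ (subvf <<1; x>>%AS)); apply/FadjoinP; split; first exact: sub1v.
  by apply/fixedFieldP; rewrite ?memvf // => z /set1P ->.
by move/subsetP/(_ sigma (set11 _)).
Qed.

Lemma fixed_by_gal x : (forall sigma, sigma \in GalL -> sigma x = x) -> x \in 1%VS.
Proof.
move=> h; have /galois_fixedField <- := galois_over_rat 1%AS.
by apply/fixedFieldP; rewrite ?memvf.
Qed.

Lemma gal_sqrt x q sigma : x ^+ 2 = q%:A -> sigma \in GalL ->
  sigma x = x \/ sigma x = - x.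
Proof.
move=> xq Gs; have : sigma x ^+ 2 = x ^+ 2.
  by rewrite -rmorphXn /= xq linearZ /= rmorph1.
by move/eqP; rewrite eqf_sqr => /orP[] /eqP; [left | right].
Qed.

Lemma sqrt_notin_rat x q : x ^+ 2 = q%:A -> (forall r : rat, r ^+ 2 != q) -> x \notin 1%VS.
Proof.
move=> xq nq; apply/vlineP => -[c xE]; case/eqP: (nq c).
apply: (fmorph_inj (in_alg L)); rewrite rmorphXn /= -[c%:A]xE xq //.
Qed.

Lemma dim_sqrt x q : x ^+ 2 = q%:A -> (forall r : rat, r ^+ 2 != q) ->
  \dim <<1; x>> = 2.
Proof.
move=> xq nq; have nx := sqrt_notin_rat xq nq.
rewrite (dim_Fadjoin 1%AS) dimv1 muln1; apply/eqP; rewrite eqn_leq; apply/andP; split.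
  have p0 : 'X^2 - (q%:A)%:P != 0 :> {poly L} by rewrite -size_poly_eq0 size_XnsubC.
  have : (size (minPoly 1 x) <= size ('X^2 - (q%:A)%:P : {poly L})%R)%N.
    rewrite dvdp_leq // minPoly_dvdp //.
      by rewrite rpredB ?rpredX ?polyOverX ?polyOverC ?rpredZ ?rpred1 ?mem1v.
    by rewrite rootE !hornerE xq subrr.
  by rewrite size_XnsubC // size_minPoly ltnS.
rewrite ltn_neqAle eq_sym adjoin_deg_eq1 nx /=.
by rewrite /adjoin_degree.
Qed.

(** If the groups were equal, each automorphism would act on x and y by the same sign and so fix x
    y. *)
Lemma gal_sqrt_neq x y p q : x ^+ 2 = p%:A -> y ^+ 2 = q%:A -> x * y \notin 1%VS ->
  'Gal({:L} / <<1; x>>) != 'Gal({:L} / <<1; y>>).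
Proof.
move=> xp yq; apply: contraNneq => e; apply: fixed_by_gal => s Gs.
have := mem_gal_adjoin y Gs; rewrite -e mem_gal_adjoin // rmorphM /=.
have [->|sx] := gal_sqrt xp Gs; first by rewrite eqxx => /esym/eqP ->.
have [->|sy] := gal_sqrt yq Gs; first by rewrite eqxx => /eqP ->.
by rewrite sx sy mulrNN.
Qed.
End QuadraticSubfields.

(** * Monomial representations *)

Section GroupOfOrder16.
Variables (gT : finGroupType) (G : {group gT}) (rG : mx_representation 'F_5 G 2).
Hypothesis rG_faithful : forall x, x \in G -> rG x = 1%:M -> x = 1%g.
Hypothesis rG_im : (reprGLm rG @* G = G16)%g.
Implicit Types H : {group gT}.

Lemma reprGLm_inj : 'injm (reprGLm rG).
Proof.
apply/subsetP => x; rewrite ker_reprGLm => /rkerP[Gx x1].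
by rewrite inE; apply/eqP/rG_faithful.
Qed.

Lemma reprGLm_preim c : c \in G16 -> exists2 x, x \in G & reprGLm rG x = c.
Proof. by rewrite -rG_im => /morphimP[x Gx _ ->]; exists x. Qed.

Lemma reprGLm_gen x y c d : x \in G -> y \in G -> reprGLm rG x = c -> reprGLm rG y = d ->
  G16 :=: <<[set c; d]>>%g -> G :=: <<[set x; y]>>%g.
Proof.
move=> Gx Gy ex ey defG; have sxyG : [set x; y] \subset G.
  by apply/subsetP => z /set2P[] ->.
apply/eqP; rewrite eq_sym eqEcard gen_subG sxyG /=.
rewrite -(card_injm reprGLm_inj) // -[X in (_ <= X)%N](card_injm reprGLm_inj) ?gen_subG //.
by rewrite morphim_gen // morphimU !morphim_set1 // rG_im defG -ex -ey.
Qed.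

(** The image of H contains c and has half the order of [G16], so the bound on <c> leaves no room
    for more. *)
Lemma morphim_cycle_index2 H x c : H \subset G -> #|G : H| = 2 -> x \in H ->
  reprGLm rG x = c -> (#|G16| <= 2 * #|<[c]>%g|)%N -> (reprGLm rG @* H = <[c]>)%g.
Proof.
move=> sHG iH Hx xc leG.
apply/esym/eqP; rewrite eqEcard cycle_subG -xc mem_morphim ?(subsetP sHG) //=.
rewrite card_injm ?reprGLm_inj // xc -(leq_pmul2l (isT : (0 < 2)%N)) (leq_trans _ leG) //.
by rewrite -rG_im card_injm ?reprGLm_inj // -(Lagrange sHG) iH mulnC.
Qed.

Section Monomial.
Variables (F25 : fieldExtType 'F_5) (H : {group gT}) (c : {'GL_2['F_5]}) (eta : F25).
Hypotheses (sHG : H \subset G) (iH : #|G : H| = 2).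
Hypothesis Hc : (reprGLm rG @* H = <[c]>)%g.
Hypothesis eta0 : eta != 0.
Let rF := map_repr (in_alg F25) rG.
(** This is an eigenvector of the antidiagonal matrix with entries 1 and eta^2, which is a when
    eta^2 = 2 and ab when eta^2 = 3. *)
Let w : 'rV[F25]_2 := \row_j if j == 0 then eta else 1.
Hypothesis wc : w *m map_mx (in_alg F25) (val c) = eta *: w.
Variable y : gT.
Hypotheses (Gy : y \in G) (yb : reprGLm rG y = gl_b).

Lemma natr5_F25 : (5 : F25) = 0.
Proof.
have e : (5 : 'F_5) = 0 by apply: val_inj.
by rewrite -(rmorph_nat (in_alg F25) 5) e rmorph0.
Qed.

Lemma eigen_cycle h : h \in H -> exists a, w *m subg_repr rF sHG h = a *: w.
Proof.
move=> Hh; have Gh := subsetP sHG h Hh.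
have : reprGLm rG h \in <[c]>%g by rewrite -Hc; apply: mem_morphim.
case/cycleP=> k ek; rewrite /= /subg_repr /= /map_repr_mx -(val_reprGLm _ Gh) ek.
elim: k {ek} => [|k [a IH]].
  by exists 1; rewrite expg0 map_mx1 mulmx1 scale1r.
exists (eta * a); rewrite expgS GLmulE map_mxM mulmxA wc -scalemxAl.
by rewrite IH scalerA.
Qed.

Let w1 : w 0 1 = 1. Proof. by rewrite mxE. Qed.

Lemma monomial_basis (v : 'rV[F25]_2) : exists a b, v = a *: w + b *: (w *m rF y).
Proof.
have c5 := natr5_F25.
have e4 : (4 : F25) = -1 by apply/eqP; rewrite -subr_eq0 opprK -c5; apply/eqP; ring.
have e2 : (2 : F25) * 3 = 1 by rewrite -[RHS]addr0 -c5; ring.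
have wb : w *m rF y = \row_j (if j == 0 then - eta else 1).
  have -> : rF y = mx2 (-1) 0 0 1.
    rewrite /= /map_repr_mx -(val_reprGLm _ Gy) yb /=.
    apply/matrixP; case=> [[|[|?]] ?]; case=> [[|[|?]] ?]; rewrite // !mxE /= ?scale0r ?scale1r //.
    by rewrite -e4 -(rmorph_nat (in_alg F25)).
  rewrite row_mul_mx2; apply/rowP => j; rewrite !mxE /=.
  by case: ifP => _; rewrite ?mulrN1 ?mulr0 ?addr0 ?add0r ?mulr1.
(* The vectors (eta, 1) and (- eta, 1) form a basis; 3 is the inverse of 2 in characteristic 5. *)
exists (3 * (v 0 1 + v 0 0 / eta)), (3 * (v 0 1 - v 0 0 / eta)).
apply/rowP => j; rewrite wb !mxE.
have [->|] := eqVneq j 0.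
  transitivity (2 * 3 * v 0 0); first by rewrite e2 mul1r.
  by field.
move=> j0; have -> : j = 1 by apply: val_inj; move: j j0 => [[|[|?]] ?].
transitivity (2 * 3 * v 0 1); first by rewrite e2 mul1r.
by field.
Qed.

Lemma monomial_rsim : exists r : mx_representation F25 H 1,
  (forall x, x \in H -> reprGLm rG x = c -> r x = eta%:M) /\
  mx_rsim rF (induced_repr sHG r).
Proof.
exists (eigen_repr w1 eigen_cycle); split=> [x Hx xc|].
  rewrite /= /eigen_mx /= /subg_repr /= /map_repr_mx.
  by rewrite -(val_reprGLm _ (subsetP sHG x Hx)) xc wc mxE w1 mulr1.
apply: mx_rsim_sym; apply: (induced_rsim sHG iH _ Gy monomial_basis) => h Hh.
by rewrite (eigen_mxE w1 eigen_cycle Hh) /= /eigen_mx mul_scalar_mx.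
Qed.
End Monomial.
End GroupOfOrder16.

(** * Changes of basis *)

Section ConjugateRepresentation.
Variables (gT : finGroupType) (G : {group gT}) (K F : fieldType) (f : {rmorphism K -> F}).
Variables (n : nat) (rG : mx_representation K G n) (B : 'M[K]_n) (uB : B \in unitmx).

Lemma map_rconj_rsim : mx_rsim (map_repr f rG) (map_repr f (rconj_repr rG uB)).
Proof.
exists (map_mx f (invmx B)) => // [|x Gx].
  by rewrite row_free_unit map_unitmx unitmx_inv.
by rewrite /= /map_repr_mx -!map_mxM /= rconj_mxE -mulmxA mulKmx.
Qed.
End ConjugateRepresentation.

Section ChangeOfBasis.
Variables (E : weierstrass rat) (L : splittingFieldType rat) (iota : {rmorphism L -> algC}).
Variables (e : 'rV['F_5]_2 -> point algC) (rho : mx_representation 'F_5 'Gal({:L} / 1) 2).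
Hypotheses (e_basis : torsion5_basis E e) (rho_def : torsion5_repr iota e rho).
Variables (B : 'M['F_5]_2) (uB : B \in unitmx).

Lemma torsion5_basis_conj : torsion5_basis E (fun v => e (v *m B)).
Proof.
have [eD e_inj eT] := e_basis; split=> [u v|u v /e_inj/(can_inj (mulmxK uB)) //|P].
  by rewrite mulmxDl eD.
rewrite eT; split=> -[v <-]; last by exists (v *m B).
by exists (v *m invmx B); rewrite mulmxKV.
Qed.

Lemma torsion5_repr_conj : torsion5_repr iota (fun v => e (v *m B)) (rconj_repr rho uB).
Proof. by move=> s Gs P v Pv; rewrite rconj_mxE !mulmxA mulmxKV // (rho_def Gs Pv). Qed.
End ChangeOfBasis.

(** [rconj_repr] conjugates as x g x^-1 and [^] as x^-1 g x, hence the inverse. *)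
Lemma reprGLm_rconj (gT : finGroupType) (G : {group gT}) (rG : mx_representation 'F_5 G 2)
    (x : {'GL_2['F_5]}) (ux : GLval x \in unitmx) g :
  g \in G -> reprGLm (rconj_repr rG ux) g = (reprGLm rG g ^ x^-1)%g.
Proof.
move=> Gg; apply: val_inj; rewrite val_reprGLm // rconj_mxE conjgE invgK !GLmulE.
by rewrite val_reprGLm // mulmxA.
Qed.

Lemma reprGLm_rconj_im (gT : finGroupType) (G : {group gT}) (rG : mx_representation 'F_5 G 2)
    (x : {'GL_2['F_5]}) (ux : GLval x \in unitmx) :
  (reprGLm (rconj_repr rG ux) @* G = (reprGLm rG @* G) :^ x^-1)%g.
Proof. by apply: morphim_conj => g Gg; apply: reprGLm_rconj. Qed.

Lemma fibre_value (K : fieldType) (N D D' : K) : D * D' != 0 ->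
  N / (D ^+ 5 * D' ^+ 5) * (D * D') ^+ 5 = N.
Proof. by move=> D0; rewrite -exprMn divfK // expf_neq0. Qed.

Lemma square_neq_neg (q r : rat) : q < 0 -> r ^+ 2 != q.
Proof. by apply: contraTneq => <-; rewrite -leNgt sqr_ge0. Qed.

(** In the new basis b keeps its matrix, while ab acts as the inverse of a, so that its seventh
    power acts as a. *)
Lemma swap_basis (gT : finGroupType) (G : {group gT}) (rG : mx_representation 'F_5 G 2) a b :
  (reprGLm rG @* G = G16)%g -> a \in G -> b \in G ->
  reprGLm rG a = gl_a -> reprGLm rG b = gl_b ->
  let rN := rconj_repr rG mx_n_unit in let c := (a * b)%g in
  [/\ (reprGLm rN @* G = G16)%g, reprGLm rN b = gl_b &
      reprGLm rN (c * (c * (c * (c * (c * (c * c))))))%g = gl_a].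
Proof.
move=> im Ga Gb ea eb rN c.
have ra : rG a = mx_a by rewrite -val_reprGLm // ea.
have rb : rG b = mx_b by rewrite -val_reprGLm // eb.
have Nb : reprGLm rN b = gl_b.
  by apply: val_inj; rewrite val_reprGLm // rconj_mxE rb mx_n_conj_b.
have Gc : c \in G by rewrite groupM.
have Na7 : reprGLm rN (c * (c * (c * (c * (c * (c * c))))))%g = gl_a.
  have Nc : rN c = mx_n *m (mx_a *m mx_b) *m invmx mx_n.
    by rewrite rconj_mxE repr_mxM // ra rb.
  move: c Gc Nc => c Gc Nc; apply: val_inj; rewrite val_reprGLm ?groupM //.
  by rewrite !repr_mxM ?groupM // !Nc mx_n_conj_ab.
split=> //.
pose gl_n : {'GL_2['F_5]} := FinRing.unit 'M['F_5]_2 mx_n_unit.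
have NG g : g \in G -> reprGLm rN g = (reprGLm rG g ^ gl_n^-1)%g.
  exact: (@reprGLm_rconj _ _ rG gl_n mx_n_unit).
rewrite (@reprGLm_rconj_im _ _ rG gl_n mx_n_unit) im; apply: conj_gen2.
  have -> : (gl_a ^ gl_n^-1 = gl_a * gl_b * (gl_a * gl_b * (gl_a * gl_b)))%g.
    rewrite -{1}ea -NG //; apply: val_inj.
    by rewrite val_reprGLm // rconj_mxE ra mx_n_conj_a !GLmulE.
  have := groupM gl_a_G16 gl_b_G16; move: (gl_a * gl_b)%g => d Gd.
  by rewrite (groupM Gd) // (groupM Gd).
by rewrite -{1}eb -NG // Nb gl_b_G16.
Qed.

(** * Proof of the proposition *)

Lemma field_generators (E : weierstrass rat) (L : splittingFieldType rat)
    (iota : {rmorphism L -> algC}) (t : rat)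
    (e : 'rV['F_5]_2 -> point algC) (rho : mx_representation 'F_5 'Gal({:L} / 1) 2) beta :
  ec_disc E != 0 -> ec_j E = j_map t -> division_field E 5 iota ->
  torsion5_basis E e -> torsion5_repr iota e rho ->
  beta \in 'Gal({:L} / 1) -> rho beta = mx_b ->
  exists s1 s5 : L, [/\ s1 ^+ 2 = (- (3 * t ^+ 2 + 10 * t + 15))%:A,
    s5 ^+ 2 = 5, beta s5 = s5 & (s1 * s5) ^+ 2 = (- 5 * (3 * t ^+ 2 + 10 * t + 15))%:A].
Proof.
move=> E0 Ej L_def e_basis rho_def Gb rb.
have [s5 [s5E bs5 root]] := torsion_sqrt5_fixed L_def e_basis rho_def Gb rb E0.
have [z zj zr] := root (in_alg L (fib_root t / fib_den t)).
have jE : j_map t * fib_den t ^+ 5 = 5 ^+ 4 * t ^+ 3 * (t ^+ 2 + 5 * t + 10) ^+ 3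
  * (2 * t ^+ 2 + 5 * t + 5) ^+ 3
  * (4 * t ^+ 4 + 30 * t ^+ 3 + 95 * t ^+ 2 + 150 * t + 100) ^+ 3.
  exact: (fibre_value _ (fib_den_neq0 (rat_sqr_neq5 (2 * t + 5)))).
rewrite Ej in zj.
have [s1 s1E] := sqrt_of_quintic_root (rat_sqr_neq5 (2 * t + 5)) jE s5E zj zr.
exists s1, s5; split=> //; rewrite exprMn s1E s5E.
move: (3 * t ^+ 2 + 10 * t + 15) => D.
by rewrite -[in LHS](rmorph_nat (in_alg L) 5) -rmorphM /=; congr (_ %:A); ring.
Qed.

Lemma antidiag_eigen (F : fieldType) (eta p : F) : p = eta ^+ 2 ->
  (\row_j if j == 0 then eta else 1) *m mx2 0 1 p 0 =
  eta *: (\row_j if j == 0 then eta else 1) :> 'rV[F]_2.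
Proof.
move=> ->; rewrite row_mul_mx2; apply/rowP => j; rewrite !mxE /=.
by case: ifP => _; rewrite ?mulr0 ?mulr1 ?mul1r ?add0r ?addr0.
Qed.

Lemma map_mx_a (F : fieldExtType 'F_5) : map_mx (in_alg F) (val gl_a) = mx2 0 1 2 0.
Proof.
apply/matrixP; case=> [[|[|?]] ?]; case=> [[|[|?]] ?]; rewrite // !mxE /= ?scale0r ?scale1r //.
by rewrite -(rmorph_nat (in_alg F)).
Qed.

Lemma map_mx_ab (F : fieldExtType 'F_5) :
  map_mx (in_alg F) (val (gl_a * gl_b)%g) = mx2 0 1 3 0.
Proof.
have -> : val (gl_a * gl_b)%g = mx2 0 1 3 0.
  by rewrite GLmulE /= /mx_a /mx_b mul_mx2; congr mx2; apply: val_inj.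
apply/matrixP; case=> [[|[|?]] ?]; case=> [[|[|?]] ?]; rewrite // !mxE /= ?scale0r ?scale1r //.
by rewrite -(rmorph_nat (in_alg F)).
Qed.

Theorem proposition7p1
    (t : rat) (E : weierstrass rat)
    (E_smooth : ec_disc E != 0) (E_j : ec_j E = j_map t)
    (L : splittingFieldType rat) (iota : {rmorphism L -> algC})
    (L_def : division_field E 5 iota)
    (e : 'rV['F_5]_2 -> point algC) (e_basis : torsion5_basis E e)
    (rho : mx_representation 'F_5 'Gal({:L} / 1) 2)
    (rho_def : torsion5_repr iota e rho)
    (rho_im : exists x : {'GL_2['F_5]},
       (reprGLm rho @* 'Gal({:L} / 1))%g = (G16 :^ x)%g) :
  exists s1 s5 s2 : L,
    [/\ s1 ^+ 2 = (- (3 * t ^+ 2 + 10 * t + 15))%:A,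
        s5 ^+ 2 = 5 &
        s2 ^+ 2 = (- 5 * (3 * t ^+ 2 + 10 * t + 15))%:A] /\
    let K1 : {subfield L} := <<1; s1>>%AS in
    let K5 : {subfield L} := <<1; s5>>%AS in
    let K2 : {subfield L} := <<1; s2>>%AS in
    [/\ uniq [:: K1; K5; K2],
        (forall K : {subfield L}, \dim K = 2%N <-> K \in [:: K1; K5; K2]) &
        exists (e' : 'rV['F_5]_2 -> point algC)
               (rho' : mx_representation 'F_5 'Gal({:L} / 1) 2),
          [/\ torsion5_basis E e', torsion5_repr iota e' rho',
              isom 'Gal({:L} / 1) G16 (reprGLm rho'),
              isom 'Gal({:L} / K1) <[gl_a]> (reprGLm rho') &
              isom 'Gal({:L} / K2) <[(gl_a * gl_b)%g]> (reprGLm rho')] /\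
          forall F25 : fieldExtType 'F_5, \dim {:F25} = 2%N ->
          let rhoF := map_repr (in_alg F25) rho in
          forall eta eta' : F25, eta ^+ 2 = 2 -> eta' ^+ 2 = 3 ->
          [/\ 3 = eta ^+ 6,
              exists r1 : mx_representation F25 'Gal({:L} / K1) 1,
                (forall sigma, sigma \in 'Gal({:L} / K1) ->
                   reprGLm rho' sigma = gl_a -> r1 sigma = eta%:M) /\
                mx_rsim rhoF (induced_repr (galS {:L} (sub1v K1)) r1) &
              exists r2 : mx_representation F25 'Gal({:L} / K2) 1,
                (forall sigma, sigma \in 'Gal({:L} / K2) ->
                   reprGLm rho' sigma = (gl_a * gl_b)%g -> r2 sigma = eta'%:M) /\
                mx_rsim rhoF (induced_repr (galS {:L} (sub1v K2)) r2)]].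
Proof.
(* In the basis changed by x the image is [G16] itself. *)
have [x im] := rho_im; have ux : GLval x \in unitmx := valP x.
pose rho0 := rconj_repr rho ux; pose e0 v := e (v *m GLval x).
have e0_basis : torsion5_basis E e0 := torsion5_basis_conj e_basis ux.
have rho0_def : torsion5_repr iota e0 rho0 := torsion5_repr_conj rho_def ux.
have im0 : (reprGLm rho0 @* 'Gal({:L} / 1) = G16)%g.
  by rewrite reprGLm_rconj_im im conjsgK.
have [a0 Ga0 a0E] := reprGLm_preim im0 gl_a_G16.
have [b Gbb b0E] := reprGLm_preim im0 gl_b_G16.
have rb : rho0 b = mx_b by rewrite -val_reprGLm // b0E.
have [s1 [s5 [s1E s5E bs5 s2E]]] :=
  field_generators E_smooth E_j L_def e0_basis rho0_def Gbb rb.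
have := fib_disc_gt0 t; move: s1E s2E; move: (3 * t ^+ 2 + 10 * t + 15) => D s1E s2E D0.
have nD0 : - D < 0 by rewrite oppr_lt0.
have nD5 : - 5 * D < 0 by rewrite mulNr oppr_lt0 pmulr_rgt0.
have s5E' : s5 ^+ 2 = 5%:A by rewrite -(rmorph_nat (in_alg L) 5) in s5E.
have n1 r : r ^+ 2 != - D := square_neq_neg r nD0.
have n2 r : r ^+ 2 != - 5 * D := square_neq_neg r nD5.
set s2 := s1 * s5 in s2E.
have sqrM (y z : L) p q : y ^+ 2 = p%:A -> z ^+ 2 = q%:A -> (y * z) ^+ 2 = (p * q)%:A.
  by move=> yE zE; rewrite exprMn yE zE -scalerAl mul1r scalerA.
(* The square of s1 s2 is 5 D^2, and 5 is not a rational square; below, that of s5 s2 is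
   negative. *)
have s12n : s1 * s2 \notin 1%VS.
  apply: (sqrt_notin_rat (sqrM _ _ _ _ s1E s2E)) => r.
  have DD : D != 0 by rewrite gt_eqF.
  apply: contraNneq (rat_sqr_neq5 (r / D)) => rE.
  by rewrite expr_div_n rE; apply/eqP; field.
have s52n : s5 * s2 \notin 1%VS.
  apply: (sqrt_notin_rat (sqrM _ _ _ _ s5E' s2E)) => r.
  by apply: square_neq_neg; rewrite pmulr_rlt0.
exists s1, s5, s2; split; [by split | move=> K1 K5 K2].
pose H1 := 'Gal({:L} / K1)%G; pose H5 := 'Gal({:L} / K5)%G; pose H2 := 'Gal({:L} / K2)%G.
have sH (K : {subfield L}) : 'Gal({:L} / K) \subset 'Gal({:L} / 1) := galS _ (sub1v K).
have d1 : \dim K1 = 2 := dim_sqrt s1E n1.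
have d5 : \dim K5 = 2 := dim_sqrt s5E' rat_sqr_neq5.
have d2 : \dim K2 = 2 := dim_sqrt s2E n2.
have iH (K : {subfield L}) : \dim K = 2 -> #|'Gal({:L} / 1) : 'Gal({:L} / K)| = 2.
  by rewrite gal_index.
have n15 : H1 :!=: H5 := gal_sqrt_neq s1E s5E' (sqrt_notin_rat s2E n2).
have n1_2 : H1 :!=: H2 := gal_sqrt_neq s1E s2E s12n.
have n5_2 : H5 :!=: H2 := gal_sqrt_neq s5E' s2E s52n.
have bH5 : b \in H5 by rewrite mem_gal_adjoin ?bs5.
have gen0 : 'Gal({:L} / 1) :=: <<[set a0; b]>>%g.
  have f0 := torsion_repr_faithful L_def e0_basis rho0_def.
  exact: (reprGLm_gen f0 im0 Ga0 Gbb a0E b0E).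
have i1 := iH _ d1; have i5 := iH _ d5; have i2 := iH _ d2.
have n2_5 : H2 :!=: H5 by rewrite eq_sym.
have [bH1 bH2 _ _] :=
  index2_triple gen0 (sH K1) (sH K2) (sH K5) i1 i2 i5 n1_2 n15 n2_5 bH5.
(* The roles of s1 and s2 are exchanged by the change of basis diag(1, 2). *)
have [e' [rho' [a [e'_basis rho'_def sim [im' Gal_a aE bE aH1]]]]] :
  exists (e' : 'rV['F_5]_2 -> point algC)
    (rho' : mx_representation 'F_5 'Gal({:L} / 1) 2) (a : gal_of {:L}),
  [/\ torsion5_basis E e', torsion5_repr iota e' rho',
      forall F25 : fieldExtType 'F_5,
        mx_rsim (map_repr (in_alg F25) rho) (map_repr (in_alg F25) rho') &
      [/\ (reprGLm rho' @* 'Gal({:L} / 1) = G16)%g, a \in 'Gal({:L} / 1),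
          reprGLm rho' a = gl_a, reprGLm rho' b = gl_b & a \in H1]].
  have [aH1|aH1] := boolP (a0 \in H1).
    exists e0, rho0, a0; split=> // F25; exact: map_rconj_rsim.
  have [imN bN aN] := swap_basis im0 Ga0 Gbb a0E b0E.
  exists (fun v => e0 (v *m mx_n)), (rconj_repr rho0 mx_n_unit).
  (* Neither [a0] nor [b] is in [H1], so their product is. *)
  have abH1 : (a0 * b)%g \in H1.
    by rewrite (index2_memM (sH _) i1) // (negPf aH1) (negPf bH1).
  have abG := subsetP (sH _) _ abH1.
  pose c := (a0 * b)%g.
  have c7 (K : {group gal_of {:L}}) : c \in K ->
      (c * (c * (c * (c * (c * (c * c))))))%g \in K.
    by move: c => c' Kc; rewrite !groupM.
  exists (c * (c * (c * (c * (c * (c * c))))))%g; split; last first.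
    by split; [exact: imN | exact: c7 | exact: aN | exact: bN | exact: (c7 H1)].
  - by move=> F25; apply: (mx_rsim_trans (map_rconj_rsim _ rho ux)); apply: map_rconj_rsim.
  - exact: torsion5_repr_conj.
  exact: (torsion5_basis_conj e0_basis mx_n_unit).
have faith := torsion_repr_faithful L_def e'_basis rho'_def.
have gen := reprGLm_gen faith im' Gal_a Gbb aE bE (erefl _).
have [_ _ _ a12] :=
  index2_triple gen (sH K1) (sH K2) (sH K5) i1 i2 i5 n1_2 n15 n2_5 bH5.
(* With a in [H1] and b in [H5] only, neither is in [H2], which therefore contains ab. *)
have aH2 : a \notin H2 by rewrite -a12.
have abH2 : (a * b)%g \in H2 by rewrite (index2_memM (sH _) i2) // (negPf aH2) (negPf bH2).
have abE : reprGLm rho' (a * b)%g = (gl_a * gl_b)%g.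
  by rewrite reprGLmM // aE bE.
have injr := reprGLm_inj faith.
have m1 := morphim_cycle_index2 faith im' (sH K1) i1 aH1 aE card_G16_a.
have m2 := morphim_cycle_index2 faith im' (sH K2) i2 abH2 abE card_G16_ab.
split.
- rewrite /= !inE !andbT negb_or -andbA; apply/and3P; split.
  + by apply: contra n15 => /eqP e15; rewrite /H1 /H5 e15.
  + by apply: contra n1_2 => /eqP e12; rewrite /H1 /H2 e12.
  by apply: contra n5_2 => /eqP e52; rewrite /H5 /H2 e52.
- move=> K; split=> [dK|]; last by rewrite !inE => /or3P[] /eqP ->.
  have [] := index2_exhaust gen (sH K1) (sH K2) (sH K5) i1 i2 i5 n1_2 n15 n2_5 bH5
    (sH K) (iH K dK); move/gal_inj => ->; by rewrite !inE eqxx ?orbT.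
exists e', rho'; split.
  split=> //.
  - by apply: (sub_isom _ im' injr).
  - by apply: (sub_isom (sH K1) m1 injr).
  by apply: (sub_isom (sH K2) m2 injr).
move=> F25 _ rhoF eta eta' etaE eta'E.
have c5 := natr5_F25 F25.
(* This gives eta^6 = 2^3 = 3 in characteristic 5. *)
have e8 : (8 : F25) = 3 by rewrite -[RHS]addr0 -c5; ring.
have e6 : (2 : F25) * 3 = 1 by rewrite -[RHS]addr0 -c5; ring.
have two0 : (2 : F25) != 0.
  by apply/negP => /eqP z2; move/eqP: e6; rewrite z2 mul0r eq_sym oner_eq0.
have three0 : (3 : F25) != 0.
  by apply/negP => /eqP z3; move/eqP: e6; rewrite z3 mulr0 eq_sym oner_eq0.
have eta0 : eta != 0 by apply: contraNneq two0 => z; rewrite -etaE z expr0n.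
have eta'0 : eta' != 0 by apply: contraNneq three0 => z; rewrite -eta'E z expr0n.
split.
- have -> : eta ^+ 6 = (eta ^+ 2) ^+ 3 by ring.
  by rewrite etaE -e8; ring.
- have [|r [r1 r2]] := monomial_rsim (galS {:L} (sub1v K1)) i1 m1 eta0 _ Gbb bE.
    rewrite map_mx_a; apply: antidiag_eigen; by rewrite etaE.
  by exists r; split=> //; apply: mx_rsim_trans (sim F25) r2.
have [|r [r1 r2]] := monomial_rsim (galS {:L} (sub1v K2)) i2 m2 eta'0 _ Gbb bE.
  rewrite map_mx_ab; apply: antidiag_eigen; by rewrite eta'E.
by exists r; split=> //; apply: mx_rsim_trans (sim F25) r2.
Qed.
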